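(* Let $q = 2^{2m+1}$ with $m > 0$, let $t = 2^{m+1}$, and let $\omega$ be a primitive element of $\mathbb{F}_q$. Then $$\mathrm{Sz}(q) \cong \langle x, y, z \mid R \cup \{z^2,\ (yz)^2,\ x z x^2 z x^{-1} z\} \rangle,$$ where, with $x_i = y^{-i} x y^i$ for $i \in \mathbb{Z}$, $R = \{x^4, y^{q-1}\} \cup R_1 \cup R_2$, $$R_1 = \bigcup_{i=1}^{2m} \bigl\{ [x_0^2, x_i],\ [x_0, x_i]\,(x_{i(t-1)}^2 x_{i(2-t)}^2)^{-1} \bigr\},$$ and $R_2$ consists of the relator $x_{2m+1}^2 x_{2m}^{2c_{2m}} \cdots x_1^{2c_1} x_0^2$ together with the relation $$x_{2m+1} x_{2m}^{d_{2m}} \cdots x_2^{d_2} x_1^{d_1} x_0 = x_{2m}^{2e_{2m}} \cdots x_2^{2e_2} x_1^{2e_1} x_0^{2e_0},$$ with the constants $c_i, d_i, e_i \in \{0,1\}$ as defined in the context. Moreover, given a generating set $Y$ of a black box group, with $|Y| = 3$, in time $O(\mu \log q)$ it can be determined if $\langle Y \rangle$ satisfies the relations of this presentation (with the elements of $Y$ in the roles of $x, y, z$).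
   Context: Notation: $g^h = h^{-1}gh$ and $[g,h] = g^{-1}h^{-1}gh$. $\mathrm{Sz}(q) = \langle \hat{x}, \hat{y}, \hat{z}\rangle \leqslant \mathrm{GL}(4,q)$, where $$\hat{x} = \begin{bmatrix} 1&0&0&0\\ 1&1&0&0\\ 1&1&1&0\\ 1&0&1&1 \end{bmatrix},\quad \hat{y} = \mathrm{diag}(\omega^{t/2+1}, \omega^{t/2}, \omega^{-t/2}, \omega^{-t/2-1}),\quad \hat{z} = \begin{bmatrix} 0&0&0&1\\ 0&0&1&0\\ 0&1&0&0\\ 1&0&0&0 \end{bmatrix}.$$ Constants: $X^{2m+1} + c_{2m}X^{2m} + \cdots + c_2X^2 + c_1X + 1$ is the minimal polynomial of $\omega^{1+t}$ over $\mathbb{F}_2$, and $X^{2m+1} + d_{2m}X^{2m} + \cdots + d_2X^2 + d_1X + 1$ is the minimal polynomial of $\omega$ over $\mathbb{F}_2$ (coefficients regarded as elements of $\{0,1\}$). Put $\hat{x}_i = \hat{y}^{-i}\hat{x}\hat{y}^i$ and $\hat{p} = \hat{x}_{2m+1}\hat{x}_{2m}^{d_{2m}} \cdots \hat{x}_1^{d_1}\hat{x}_0$. The set $\{\omega^{i(t+1)} : 0 \leqslant i \leqslant 2m\}$ is a basis of $\mathbb{F}_q$ over $\mathbb{F}_2$, and the $e_i$ are defined by expressing the $(3,1)$ entry of the matrix $\hat{p}$ as $\hat{p}_{3,1} = \sum_{i=0}^{2m} e_i \omega^{i(t+1)}$ with $e_i \in \mathbb{F}_2$ (regarded as elements of $\{0,1\}$).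 Black box group: a group whose elements are encoded as strings of uniform length over a finite alphabet, equipped with an oracle (the black box) that can construct a string representing the product of two given elements, construct a string representing the inverse of a given element, and test whether a given element is the identity. Time is measured in bit operations, and $\mu$ is the time complexity of the group operation (number of bit operations required by the black box). *)

(* Defs.v *)
From HB Require Import structures.
From mathcomp Require Import all_boot all_order all_fingroup all_algebra.
From mathcomp Require Import all_solvable all_field.
From mathcomp Require Import generic_quotient boolp.

Set Implicit Arguments.
Unset Strict Implicit.
Unset Printing Implicit Defensive.

Import GRing.Theory.
Local Open Scope group_scope.
Local Open Scope quotient_scope.

(* Free groups.  MathComp's [G \isog Grp (...)] only tests finite quotients of
   the presented group, so free and presented groups are built as quotient
   types here. *)

(* [(i, false)] is the [i]-th generator and [(i, true)] its inverse. *)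
Definition letter (n : nat) := ('I_n * bool)%type.
Definition word (n : nat) := seq (letter n).
Definition letter_inv n (l : letter n) : letter n := (l.1, ~~ l.2).
Definition word_inv n (w : word n) : word n := rev (map (@letter_inv n) w).

Inductive word_eqv (n : nat) : word n -> word n -> Prop :=
| word_eqv_cancel (u v : word n) (l : letter n) :
    word_eqv (u ++ l :: letter_inv l :: v) (u ++ v)
| word_eqv_refl w : word_eqv w w
| word_eqv_sym u v : word_eqv u v -> word_eqv v u
| word_eqv_trans u v w : word_eqv u v -> word_eqv v w -> word_eqv u w.

Section FreeGroup.
Variable n : nat.

Definition word_eqvb (u v : word n) : bool := `[< word_eqv u v >].

Fact word_eqvb_refl : reflexive word_eqvb.
Proof. by move=> u; apply/asboolP; apply: word_eqv_refl. Qed.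

Fact word_eqvb_sym : symmetric word_eqvb.
Proof.
by move=> u v; apply/idP/idP => /asboolP uv; apply/asboolP; apply: word_eqv_sym.
Qed.

Fact word_eqvb_trans : transitive word_eqvb.
Proof.
move=> v u w /asboolP uv /asboolP vw; apply/asboolP; exact: word_eqv_trans vw.
Qed.

Canonical word_equiv :=
  EquivRel word_eqvb word_eqvb_refl word_eqvb_sym word_eqvb_trans.

Definition free_group := {eq_quot word_equiv}.
HB.instance Definition _ := Choice.on free_group.

Definition free_of_word (u : word n) : free_group :=
  \pi_{eq_quot word_equiv} u.
Local Notation pi := free_of_word.

Fact free_reprK a : pi (repr a) = a. Proof. exact: reprK. Qed.

Fact free_ind (P : free_group -> Prop) : (forall u, P (pi u)) -> forall a, P a.
Proof. by move=> Pu a; rewrite -[a]free_reprK; apply: Pu. Qed.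

Fact word_eqvP u v : word_eqv u v <-> pi u = pi v.
Proof.
split=> [uv|/eqquotP/asboolP //]; by apply/eqquotP/asboolP.
Qed.

Fact word_eqv_repr u : word_eqv (repr (pi u)) u.
Proof. by apply/word_eqvP; rewrite free_reprK. Qed.

Fact word_eqv_catl (w u v : word n) : word_eqv u v -> word_eqv (w ++ u) (w ++ v).
Proof.
elim=> [u1 v1 l|u1|u1 v1 _|u1 v1 w1 _ IH1 _].
- by rewrite !catA; apply: word_eqv_cancel.
- exact: word_eqv_refl.
- exact: word_eqv_sym.
- exact: word_eqv_trans.
Qed.

Fact word_eqv_catr (w u v : word n) : word_eqv u v -> word_eqv (u ++ w) (v ++ w).
Proof.
elim=> [u1 v1 l|u1|u1 v1 _|u1 v1 w1 _ IH1 _].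
- by rewrite -!catA; apply: word_eqv_cancel.
- exact: word_eqv_refl.
- exact: word_eqv_sym.
- exact: word_eqv_trans.
Qed.

Fact letter_invK : involutive (@letter_inv n).
Proof. by case=> i b; rewrite /letter_inv /= negbK. Qed.

Fact word_invK : involutive (@word_inv n).
Proof.
move=> w; rewrite /word_inv map_rev revK -map_comp -[RHS]map_id.
by apply: eq_map => l /=; apply: letter_invK.
Qed.

Fact word_inv_cat (u v : word n) :
  word_inv (u ++ v) = word_inv v ++ word_inv u.
Proof. by rewrite /word_inv map_cat rev_cat. Qed.

Fact word_eqv_inv (u v : word n) : word_eqv u v -> word_eqv (word_inv u) (word_inv v).
Proof.
elim=> [u1 v1 l|u1|u1 v1 _|u1 v1 w1 _ IH1 _].
- rewrite -[l :: _](cat1s l) -[letter_inv l :: _]cat1s !word_inv_cat -!catA /=.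
  rewrite /word_inv /= /rev /= letter_invK; exact: word_eqv_cancel.
- exact: word_eqv_refl.
- exact: word_eqv_sym.
- exact: word_eqv_trans.
Qed.

Fact word_eqv_mulV (w : word n) : word_eqv (w ++ word_inv w) [::].
Proof.
elim: w => [|l w IHw]; first exact: word_eqv_refl.
rewrite -cat1s word_inv_cat -catA (catA w).
apply: word_eqv_trans (_ : word_eqv ([:: l] ++ [::] ++ word_inv [:: l]) _).
  by apply: word_eqv_catl; apply: word_eqv_catr.
exact: (word_eqv_cancel [::] [::] l).
Qed.

Definition free_one : free_group := pi [::].
Definition free_mul (a b : free_group) : free_group := pi (repr a ++ repr b).
Definition free_inv (a : free_group) : free_group := pi (word_inv (repr a)).

Fact free_mulE u v : free_mul (pi u) (pi v) = pi (u ++ v).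
Proof.
apply/word_eqvP; apply: word_eqv_trans (word_eqv_catl _ (word_eqv_repr v)).
exact: word_eqv_catr (word_eqv_repr u).
Qed.

Fact free_invE u : free_inv (pi u) = pi (word_inv u).
Proof. by apply/word_eqvP/word_eqv_inv/word_eqv_repr. Qed.

Fact free_mulA : associative free_mul.
Proof.
by elim/free_ind=> u; elim/free_ind=> v; elim/free_ind=> w; rewrite !free_mulE catA.
Qed.

Fact free_mul1 : left_id free_one free_mul.
Proof. by elim/free_ind=> u; rewrite free_mulE. Qed.

Fact free_mulr1 : right_id free_one free_mul.
Proof. by elim/free_ind=> u; rewrite free_mulE cats0. Qed.

Fact free_mulrV : right_inverse free_one free_inv free_mul.
Proof.
elim/free_ind=> u; rewrite free_invE free_mulE; apply/word_eqvP/word_eqv_mulV.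
Qed.

Fact free_mulV : left_inverse free_one free_inv free_mul.
Proof.
elim/free_ind=> u; rewrite free_invE free_mulE; apply/word_eqvP.
by rewrite -{2}[u]word_invK; apply: word_eqv_mulV.
Qed.

HB.instance Definition _ := isGroup.Build free_group
  free_mulA free_mul1 free_mulr1 free_mulV free_mulrV.

Definition free_gen (i : 'I_n) : free_group := pi [:: (i, false)].

End FreeGroup.

Inductive normal_closure (G : groupType) (S : G -> Prop) : G -> Prop :=
| normal_closure_gen g : S g -> normal_closure S g
| normal_closure_one : normal_closure S 1
| normal_closure_mul g h :
    normal_closure S g -> normal_closure S h -> normal_closure S (g * h)
| normal_closure_inv g : normal_closure S g -> normal_closure S g^-1
| normal_closure_conj g h : normal_closure S g -> normal_closure S (g ^ h).

(* A relation [u = v] is the pair [(u, v)]; a relator [r] is [(r, 1)]. *)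
Definition relations_hold (G : groupType) (rels : seq (G * G)) : bool :=
  all (fun r => r.1 == r.2) rels.

Section PresentedGroup.
Variables (n : nat) (rels : seq (free_group n * free_group n)).

Definition relator (g : free_group n) : Prop :=
  exists2 r, r \in rels & g = r.1 * r.2^-1.

Definition pres_eqv (g h : free_group n) : bool :=
  `[< normal_closure relator (g^-1 * h) >].

Fact pres_eqv_refl : reflexive pres_eqv.
Proof. by move=> g; apply/asboolP; rewrite mulVg; apply: normal_closure_one. Qed.

Fact pres_eqv_sym : symmetric pres_eqv.
Proof.
have sym g h : pres_eqv g h -> pres_eqv h g.
  by move=> /asboolP/normal_closure_inv; rewrite invMg invgK => ?; apply/asboolP.
by move=> g h; apply/idP/idP; apply: sym.
Qed.

Fact pres_eqv_trans : transitive pres_eqv.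
Proof.
move=> h g k /asboolP gh /asboolP hk; apply/asboolP.
by have := normal_closure_mul gh hk; rewrite mulgA mulgK.
Qed.

Canonical pres_equiv :=
  EquivRel pres_eqv pres_eqv_refl pres_eqv_sym pres_eqv_trans.

Definition presented_group := {eq_quot pres_equiv}.
HB.instance Definition _ := Choice.on presented_group.

Definition pres_of_free (g : free_group n) : presented_group :=
  \pi_{eq_quot pres_equiv} g.
Local Notation pi := pres_of_free.

Fact pres_reprK a : pi (repr a) = a. Proof. exact: reprK. Qed.

Fact pres_ind (P : presented_group -> Prop) :
  (forall g, P (pi g)) -> forall a, P a.
Proof. by move=> Pg a; rewrite -[a]pres_reprK; apply: Pg. Qed.

Fact pres_eqvP g h : normal_closure relator (g^-1 * h) <-> pi g = pi h.
Proof.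
split=> [gh|/eqquotP/asboolP //]; by apply/eqquotP/asboolP.
Qed.

Definition pres_one : presented_group := pi 1.
Definition pres_mul (a b : presented_group) : presented_group :=
  pi (repr a * repr b).
Definition pres_inv (a : presented_group) : presented_group := pi (repr a)^-1.

Fact pres_mulE g h : pres_mul (pi g) (pi h) = pi (g * h).
Proof.
have eqg : normal_closure relator ((repr (pi g))^-1 * g).
  by apply/pres_eqvP; rewrite pres_reprK.
have eqh : normal_closure relator ((repr (pi h))^-1 * h).
  by apply/pres_eqvP; rewrite pres_reprK.
apply/pres_eqvP; have := normal_closure_mul eqh (normal_closure_conj h eqg).
by rewrite /conjg invMg !mulgA mulgK.
Qed.

Fact pres_invE g : pres_inv (pi g) = pi g^-1.
Proof.
have eqg : normal_closure relator (g^-1 * repr (pi g)).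
  by apply/pres_eqvP; rewrite pres_reprK.
apply/pres_eqvP; rewrite invgK.
by have := normal_closure_conj g^-1 eqg; rewrite /conjg invgK !mulgA mulgV mul1g.
Qed.

Fact pres_mulA : associative pres_mul.
Proof.
by elim/pres_ind=> u; elim/pres_ind=> v; elim/pres_ind=> w; rewrite !pres_mulE mulgA.
Qed.

Fact pres_mul1 : left_id pres_one pres_mul.
Proof. by elim/pres_ind=> u; rewrite pres_mulE mul1g. Qed.

Fact pres_mulr1 : right_id pres_one pres_mul.
Proof. by elim/pres_ind=> u; rewrite pres_mulE mulg1. Qed.

Fact pres_mulV : left_inverse pres_one pres_inv pres_mul.
Proof. by elim/pres_ind=> u; rewrite pres_invE pres_mulE mulVg. Qed.

Fact pres_mulrV : right_inverse pres_one pres_inv pres_mul.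
Proof. by elim/pres_ind=> u; rewrite pres_invE pres_mulE mulgV. Qed.

HB.instance Definition _ := isGroup.Build presented_group
  pres_mulA pres_mul1 pres_mulr1 pres_mulV pres_mulrV.

End PresentedGroup.

Definition group_isomorphic (G H : groupType) : Prop :=
  exists2 f : G -> H, {morph f : x y / x * y} & bijective f.

(* The presentation of Sz(q), q = 2^(2m+1), t = 2^(m+1).  Its relations are
   written over an arbitrary group so that they can be read both in the free
   group and in a given group.  Of [c], [d] and [e] only c_1, ..., c_2m,
   d_1, ..., d_2m and e_0, ..., e_2m are used. *)

Definition Sz_q (m : nat) : nat := (2 ^ (2 * m).+1)%N.
Definition Sz_t (m : nat) : nat := (2 ^ m.+1)%N.

Definition expgz (G : groupType) (g : G) (k : int) : G :=
  match k with Posz n => g ^+ n | Negz n => g ^- n.+1 end.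

Section SzRelations.
Variables (m : nat) (c d e : nat -> bool) (G : groupType) (x y z : G).

Local Notation q := (Sz_q m).
Local Notation t := (Sz_t m).

Definition Sz_x (i : int) : G := x ^ expgz y i.

Definition Sz_R1_at (i : nat) : seq (G * G) :=
  let i1 := (i%:Z * (t%:Z - 1))%R in
  let i2 := (i%:Z * (2%:Z - t%:Z))%R in
  [:: ([~ Sz_x 0 ^+ 2, Sz_x i%:Z], 1);
      ([~ Sz_x 0, Sz_x i%:Z] * (Sz_x i1 ^+ 2 * Sz_x i2 ^+ 2)^-1, 1)].

Definition Sz_R1 : seq (G * G) :=
  flatten [seq Sz_R1_at i | i <- index_iota 1 (2 * m).+1].

Definition Sz_R2 : seq (G * G) :=
  [:: (Sz_x (2 * m).+1%:Z ^+ 2 *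
       \prod_(i <- rev (index_iota 1 (2 * m).+1)) Sz_x i%:Z ^+ (2 * c i) *
       Sz_x 0 ^+ 2, 1);
      (Sz_x (2 * m).+1%:Z *
       \prod_(i <- rev (index_iota 1 (2 * m).+1)) Sz_x i%:Z ^+ (d i) *
       Sz_x 0,
       \prod_(i <- rev (index_iota 0 (2 * m).+1)) Sz_x i%:Z ^+ (2 * e i))].

Definition Sz_relations : seq (G * G) :=
  [:: (x ^+ 4, 1); (y ^+ (q - 1), 1)] ++ Sz_R1 ++ Sz_R2 ++
  [:: (z ^+ 2, 1); ((y * z) ^+ 2, 1); (x * z * x ^+ 2 * z * x^-1 * z, 1)].

End SzRelations.

Definition Sz_presentation (m : nat) (c d e : nat -> bool) : groupType :=
  presented_group (Sz_relations m c d e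
    (free_gen (inord 0 : 'I_3)) (free_gen (inord 1)) (free_gen (inord 2))).

(* The matrix group Sz(q). *)

Section SzMatrices.
Local Open Scope ring_scope.
Variables (F : finFieldType) (m : nat) (w : F).

Definition mx4 (rows : seq (seq F)) : 'M[F]_4 :=
  \matrix_(i < 4, j < 4) nth 0 (nth [::] rows i) j.

Definition Sz_xhat : 'M[F]_4 := mx4
  [:: [:: 1; 0; 0; 0];
      [:: 1; 1; 0; 0];
      [:: 1; 1; 1; 0];
      [:: 1; 0; 1; 1]].

Definition Sz_yhat : 'M[F]_4 := diag_mx (\row_(j < 4) nth 0
  [:: w ^+ (Sz_t m)./2.+1; w ^+ (Sz_t m)./2;
      w ^- (Sz_t m)./2; w ^- (Sz_t m)./2.+1] j).

Definition Sz_zhat : 'M[F]_4 := mx4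
  [:: [:: 0; 0; 0; 1];
      [:: 0; 0; 1; 0];
      [:: 0; 1; 0; 0];
      [:: 1; 0; 0; 0]].

Lemma Sz_xhat_unit : Sz_xhat \in unitmx.
Proof.
have tr : is_trig_mx Sz_xhat.
  apply/is_trig_mxP=> -[[|[|[|[|i]]]] Hi] -[[|[|[|[|j]]]] Hj] //= _;
  by rewrite mxE.
rewrite unitmxE det_trig // !big_ord_recl big_ord0 !mxE /= !mulr1.
exact: unitr1.
Qed.

Lemma Sz_zhat_unit : Sz_zhat \in unitmx.
Proof.
suff zz : Sz_zhat *m Sz_zhat = 1%:M by have [] := mulmx1_unit zz.
apply/matrixP=> -[[|[|[|[|i]]]] Hi] [[|[|[|[|j]]]] Hj] //;
  by rewrite !mxE !big_ord_recl big_ord0 !mxE /= ?(mulr0, mul0r, mulr1, addr0, add0r).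
Qed.

Lemma Sz_yhat_unit : w != 0 -> Sz_yhat \in unitmx.
Proof.
move=> w0; rewrite unitmxE det_diag unitfE prodf_seq_neq0; apply/allP=> i _ /=.
rewrite mxE; case: i => [[|[|[|[|i]]]] Hi] //=; by rewrite ?invr_eq0 expf_neq0.
Qed.

(* The subgroup of GL(4, q) generated by the three matrices, which are
   invertible by the lemmas above. *)
Definition Sz : {group {'GL_4[F]}} :=
  <<[set g : {'GL_4[F]} | GLval g \in [:: Sz_xhat; Sz_yhat; Sz_zhat]]>>%G.

Definition Sz_xhat_ (i : nat) : 'M[F]_4 := Sz_yhat ^- i * Sz_xhat * Sz_yhat ^+ i.

Definition Sz_phat (d : nat -> bool) : 'M[F]_4 :=
  Sz_xhat_ (2 * m).+1 *
  (\prod_(i <- rev (index_iota 1 (2 * m).+1)) Sz_xhat_ i ^+ (d i)) *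
  Sz_xhat_ 0.

End SzMatrices.

Lemma Sz_pchar (F : finFieldType) (m : nat) :
  #|F| = Sz_q m -> 2 \in [pchar F]%R.
Proof. by move=> /card_finPcharP; apply. Qed.

(* [pPrimeCharType ch] is [F] seen as an extension of the prime field 'F_2, and
   [minPoly 1 a] is the minimal polynomial of [a] over 'F_2, with its
   coefficients embedded in [F].  The (3, 1) entry has 0-based indices (2, 0). *)
Definition Sz_constants (F : finFieldType) (m : nat) (hF : #|F| = Sz_q m)
    (w : F) (c d e : nat -> bool) : Prop :=
  let L : fieldExtType 'F_2 := pPrimeCharType (Sz_pchar hF) in
  let N := (2 * m).+1 in
  [/\ minPoly 1%AS ((w ^+ (1 + Sz_t m))%R : L) =
        ('X^N + \sum_(1 <= i < N) (c i)%:R *: 'X^i + 1)%R,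
      minPoly 1%AS (w : L) =
        ('X^N + \sum_(1 <= i < N) (d i)%:R *: 'X^i + 1)%R
    & (Sz_phat m w d (inord 2) (inord 0) =
        \sum_(0 <= i < N) (e i)%:R * w ^+ (i * (Sz_t m + 1)))%R].

(* Black box groups.  A string need not encode an element, and an element may
   be encoded by several strings.  [bb_time] is the number mu of bit operations
   charged for each call to the oracle. *)

Record black_box (gT : finGroupType) := BlackBox {
  bb_alphabet : finType;
  bb_length : nat;
  bb_string := (bb_length.-tuple bb_alphabet)%type;
  bb_decode : bb_string -> option gT;
  bb_mul : bb_string -> bb_string -> bb_string;
  bb_inv : bb_string -> bb_string;
  bb_is1 : bb_string -> bool;
  bb_time : nat;
  bb_decode_surj : forall g, exists s, bb_decode s = Some g;
  bb_mulP : forall s1 s2 g1 g2, bb_decode s1 = Some g1 ->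
    bb_decode s2 = Some g2 -> bb_decode (bb_mul s1 s2) = Some (g1 * g2);
  bb_invP : forall s g, bb_decode s = Some g ->
    bb_decode (bb_inv s) = Some g^-1;
  bb_is1P : forall s g, bb_decode s = Some g -> bb_is1 s = (g == 1);
  bb_time_gt0 : (0 < bb_time)%N
}.

(* Black box algorithms are programs for a machine with two-way infinite work
   tapes over {blank, 0, 1} and with registers holding strings of the black box
   group, which are only accessible through the oracle.  A program mentions
   finitely many tapes and registers, and does not depend on the group. *)

(* [Tape l a r]: head on [a], [l] (nearest cell first) on its left, [r] on its
   right; the cells further away are blank ([None]). *)
Record tape := Tape {
  tape_left : seq (option bool);
  tape_head : option bool;
  tape_right : seq (option bool)
}.

Definition tape_move_left (T : tape) : tape :=
  Tape (behead (tape_left T)) (head None (tape_left T))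
       (tape_head T :: tape_right T).
Definition tape_move_right (T : tape) : tape :=
  Tape (tape_head T :: tape_left T) (head None (tape_right T))
       (behead (tape_right T)).
Definition tape_write (a : option bool) (T : tape) : tape :=
  Tape (tape_left T) a (tape_right T).
Definition tape_of_bits (s : seq bool) : tape :=
  let s' := map Some s in Tape [::] (head None s') (behead s').

Inductive test :=
| TestSymbol of nat & option bool
| TestOne of nat.

Inductive program :=
| Skip
| MoveLeft of nat
| MoveRight of nat
| Write of nat & option bool
| Mul of nat & nat & nat
| Inv of nat & nat
| Seq of program & program
| If of test & program & program
| While of test & program.

Section Execution.
Variables (gT : finGroupType) (B : black_box gT).

Record state := State {
  st_tape : nat -> tape;
  st_reg : nat -> option (bb_string B)
}.

Definition set_tape (k : nat) (f : tape -> tape) (st : state) : state :=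
  State (fun j => if j == k then f (st_tape st j) else st_tape st j) (st_reg st).
Definition set_reg (k : nat) (s : bb_string B) (st : state) : state :=
  State (st_tape st) (fun j => if j == k then Some s else st_reg st j).

Definition eval_test (b : test) (st : state) : option bool :=
  match b with
  | TestSymbol k a => Some (tape_head (st_tape st k) == a)
  | TestOne r => omap (@bb_is1 _ B) (st_reg st r)
  end.

Definition test_time (b : test) : nat :=
  match b with TestSymbol _ _ => 1 | TestOne _ => bb_time B end.

(* [exec P st st' n]: started in [st], [P] halts in [st'] after [n] bit
   operations.  Using an empty register is an error, i.e. there is no run. *)
Inductive exec : program -> state -> state -> nat -> Prop :=
| exec_skip st : exec Skip st st 1
| exec_left k st : exec (MoveLeft k) st (set_tape k tape_move_left st) 1
| exec_right k st : exec (MoveRight k) st (set_tape k tape_move_right st) 1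
| exec_write k a st : exec (Write k a) st (set_tape k (tape_write a) st) 1
| exec_mul r r1 r2 s1 s2 st :
    st_reg st r1 = Some s1 -> st_reg st r2 = Some s2 ->
    exec (Mul r r1 r2) st (set_reg r (bb_mul s1 s2) st) (bb_time B)
| exec_inv r r1 s1 st :
    st_reg st r1 = Some s1 ->
    exec (Inv r r1) st (set_reg r (bb_inv s1) st) (bb_time B)
| exec_seq P1 P2 st1 st2 st3 n1 n2 :
    exec P1 st1 st2 n1 -> exec P2 st2 st3 n2 ->
    exec (Seq P1 P2) st1 st3 (n1 + n2)
| exec_if_true b P1 P2 st st' n :
    eval_test b st = Some true -> exec P1 st st' n ->
    exec (If b P1 P2) st st' (test_time b + n)
| exec_if_false b P1 P2 st st' n :
    eval_test b st = Some false -> exec P2 st st' n ->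
    exec (If b P1 P2) st st' (test_time b + n)
| exec_while_true b P st1 st2 st3 n1 n2 :
    eval_test b st1 = Some true ->
    exec P st1 st2 n1 -> exec (While b P) st2 st3 n2 ->
    exec (While b P) st1 st3 (test_time b + n1 + n2)
| exec_while_false b P st :
    eval_test b st = Some false -> exec (While b P) st st (test_time b).

Lemma exec_det P st st1 st2 n1 n2 :
  exec P st st1 n1 -> exec P st st2 n2 -> st1 = st2 /\ n1 = n2.
Proof.
move=> ex1; elim: ex1 st2 n2 => {P st st1 n1}
  [st|k st|k st|k a st|r r1 r2 s1 s2 st e1 e2|r r1 s1 st e1
  |P1 P2 st1 st2 st3 n1 n2 _ IH1 _ IH2|b P1 P2 st st' n e1 _ IH
  |b P1 P2 st st' n e1 _ IH|b P st1 st2 st3 n1 n2 e1 _ IH1 _ IH2|b P st e1]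
  st0 n0 ex; inversion ex; subst; try by [];
  repeat match goal with
  | H : ?a = Some ?u, H' : ?a = Some ?v |- _ =>
      move: H'; rewrite H => -[] ?; subst; try by []
  end;
  repeat match goal with
  | H : exec ?P ?st _ _, IH : forall _ _, exec ?P ?st _ _ -> _ |- _ =>
      case: (IH _ _ H) => ? ?; subst; clear H
  end; by [].
Qed.

Definition input_state (ts : seq (seq bool)) (rs : seq (bb_string B)) : state :=
  State (fun k => tape_of_bits (nth [::] ts k))
        (fun k => nth None (map Some rs) k).

(* The answer is the bit under the head of tape 0. *)
Definition answer (st : state) : bool := tape_head (st_tape st 0) == Some true.

End Execution.

(* What a program is told about the presentation: m in unary on tape 1 and the
   constants c_1 ... c_2m, d_1 ... d_2m and e_0 ... e_2m on tapes 2, 3 and 4. *)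
Definition Sz_input (m : nat) (c d e : nat -> bool) : seq (seq bool) :=
  [:: [::]; nseq m true;
      [seq c i | i <- index_iota 1 (2 * m).+1];
      [seq d i | i <- index_iota 1 (2 * m).+1];
      [seq e i | i <- index_iota 0 (2 * m).+1]].

(* Main.v *)
From HB Require Import structures.
Require Import Defs.
From mathcomp Require Import all_boot all_fingroup all_algebra all_solvable all_field.
From mathcomp Require Import generic_quotient boolp ring zify.

(* Let U be the subgroup generated by the x_i in the presented group G.  By R_1
   and R_2 the squares of the x_i generate a central subgroup of U spanned by
   x_0^2, ..., x_2m^2, and modulo it U is elementary abelian, spanned by
   x_0, ..., x_2m.  Mapping to matrices and using that the powers w^i, and the
   powers w^(i(t+1)), with i <= 2m, are linearly independent over F_2, one finds
   that B = <y>U embeds in GL(4, q), where U becomes the group of the lower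
   unitriangular matrices S(a, b) = Sz_lower m a b, with product
   S(a, b) S(c, d) = S(a + c, b + d + a^t c).

   Then G = B u BzB.  For this z u z must lie in B u BzB for u in U.  The last
   relation, conjugated by powers of y, gives this for u = x_k^2 and u = x_k; as
   z x_-i^2 x_-j^2 z = x_i^-1 y^-2i (z x_i x_j^-1 z) y^2j x_j, and as
   x_-i^2 x_-j^2 is 1 or some x_k^2, it also holds for u = x_i x_j^-1.  These
   are all the elements of U, because S(a, b) with a <> 0 is
   S(h, h^(t+1)) S(l, l^(t+1))^-1 with h^t = b/a and l = a + h.
   As z is not mapped to a lower triangular matrix, the kernel is trivial.

   The program stays linear in m because x_(i(t-1)) and x_(i(2-t)) are obtained
   from their predecessors by one conjugation, by y^(t-1) and y^(2-t). *)

Set Implicit Arguments.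
Unset Strict Implicit.
Unset Printing Implicit Defensive.

Import GRing.Theory.
Local Open Scope group_scope.

(** * Homomorphisms from presented groups *)

Lemma morphM_monoid_morphism (G H : groupType) (f : G -> H) :
  {morph f : a b / a * b} -> monoid.monoid_morphism f.
Proof.
move=> fM; split=> //; apply: (mulgI (f 1)).
by rewrite -fM !mulg1.
Qed.

Section FreeLift.
Variables (n : nat) (G : groupType) (f : 'I_n -> G).

Definition letter_val (l : letter n) : G := if l.2 then (f l.1)^-1 else f l.1.
Definition word_val (s : word n) : G := \prod_(l <- s) letter_val l.

Lemma word_val_cat u v : word_val (u ++ v) = word_val u * word_val v.
Proof. exact: big_cat. Qed.

Lemma word_val_eqv u v : word_eqv u v -> word_val u = word_val v.
Proof.
elim=> // [u1 v1 l|u1 v1 w1 _ -> _ -> //].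
rewrite !word_val_cat -cat1s -[letter_inv l :: _]cat1s !word_val_cat.
congr (_ * _); rewrite mulgA /word_val !big_seq1 /letter_val /=.
by case: l.2; rewrite /= ?mulVg ?mulgV mul1g.
Qed.

Definition free_val (a : free_group n) : G := word_val (repr a).

Lemma free_val_word u : free_val (free_of_word u) = word_val u.
Proof. exact/word_val_eqv/word_eqv_repr. Qed.

Fact free_valM : {morph free_val : a b / a * b}.
Proof.
elim/free_ind=> u; elim/free_ind=> v.
by rewrite [_ * _]free_mulE !free_val_word word_val_cat.
Qed.

HB.instance Definition _ := 
  isUMagmaMorphism.Build _ _ free_val (morphM_monoid_morphism free_valM).

Lemma free_val_gen i : free_val (free_gen i) = f i.
Proof. by rewrite free_val_word /word_val big_seq1. Qed.

End FreeLift.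

Section PresentedLift.
Variables (n : nat) (rels : seq (free_group n * free_group n)).
Local Notation P := (presented_group rels).

Fact pres_of_freeM : {morph @pres_of_free n rels : g h / g * h}.
Proof. by move=> g h; rewrite [RHS]pres_mulE. Qed.

HB.instance Definition _ :=
  isUMagmaMorphism.Build _ _ (@pres_of_free n rels)
    (morphM_monoid_morphism pres_of_freeM).

Lemma pres_of_free_rel r : r \in rels ->
  pres_of_free rels r.1 = pres_of_free rels r.2.
Proof.
move=> rP; apply/esym/pres_eqvP.
have -> : r.2^-1 * r.1 = (r.1 * r.2^-1) ^ r.2 by rewrite /conjg mulgVK.
by apply/normal_closure_conj/normal_closure_gen; exists r.
Qed.

(** Words grow at their right end, so only right multiplication by a letter has to be checked.
    Inverse letters form a separate case, as the generators of an arbitrary presentation need not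
    have finite order. *)
Lemma pres_gen_ind (A : P -> Prop) : A 1 ->
    (forall i a, A a -> A (a * pres_of_free rels (free_gen i))) ->
    (forall i a, A a -> A (a * (pres_of_free rels (free_gen i))^-1)) ->
  forall a, A a.
Proof.
move=> A1 Agen Ainv; elim/pres_ind=> g; elim/free_ind: g => u.
elim/last_ind: u => [|u l IHu].
- suff <- : 1 = pres_of_free rels 1 by [].
  exact/esym/gmulf1.
rewrite -cats1 -free_mulE [pres_of_free _ _]pres_of_freeM.
case: l => i [] /=; last exact: Agen.
have -> : free_of_word [:: (i, true)] = (free_gen i)^-1 :> free_group n.
  by rewrite [RHS]free_invE.
by rewrite gmulfV; apply: Ainv.
Qed.

Variables (G : groupType) (f : 'I_n -> G).
Hypothesis relsG : {in rels, forall r, free_val f r.1 = free_val f r.2}.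

Definition pres_val (a : P) : G := free_val f (repr a).

(** Well-definedness on classes: two representatives differ by an element of the normal closure of
    the relators, and induction on that closure shows that [free_val f] sends it to 1. *)
Lemma pres_val_free g : pres_val (pres_of_free rels g) = free_val f g.
Proof.
have /pres_eqvP : pres_of_free rels g = pres_of_free rels (repr (pres_of_free rels g)).
  by rewrite pres_reprK.
rewrite /pres_val; set h := repr _ => ngh.
suff: free_val f (g^-1 * h) = 1.
  by rewrite gmulfM gmulfV => /(congr1 (mulg (free_val f g))); rewrite mulVKg mulg1.
elim: ngh => [_ [r rP ->]||a b _ IHa _ IHb|a _ IHa|a b _ IHa].
- by rewrite gmulfM gmulfV /= relsG // mulgV.
- exact: gmulf1.
- by rewrite gmulfM /= IHa IHb mulg1.
- by rewrite gmulfV /= IHa invg1.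
- by rewrite gmulfJ /= IHa conj1g.
Qed.

Lemma pres_valM : {morph pres_val : a b / a * b}.
Proof.
elim/pres_ind=> g; elim/pres_ind=> h.
by rewrite [_ * _]pres_mulE !pres_val_free gmulfM.
Qed.

Lemma pres_val_gen i : pres_val (pres_of_free rels (free_gen i)) = f i.
Proof. by rewrite pres_val_free free_val_gen. Qed.

End PresentedLift.

Section SzRelationsMorphism.
Variables (m : nat) (c d e : nat -> bool) (G H : groupType).
Variables (h : UMagmaMorphism.type G H) (x y z : G).

Lemma gmulf_expgz (g : G) k : h (expgz g k) = expgz (h g) k.
Proof. by case: k => k; rewrite /= ?gmulfV gmulfXn. Qed.

Lemma gmulf_Sz_x k : h (Sz_x x y k) = Sz_x (h x) (h y) k.
Proof. by rewrite /Sz_x gmulfJ gmulf_expgz. Qed.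

(** Serves twice: to evaluate the relations of the free generators in GL(4, q), and to transport
    them to the presented group. *)
Lemma Sz_relations_morph :
  Sz_relations m c d e (h x) (h y) (h z) =
  [seq (h r.1, h r.2) | r <- Sz_relations m c d e x y z].
Proof.
rewrite /Sz_relations !map_cat /= /Sz_R1 map_flatten -map_comp.
rewrite !(gmulf_Sz_x, gmulf_prod, gmulf1, gmulfXn, gmulfV, gmulfM).
have prodE (r : seq nat) (f : nat -> nat) :
    \prod_(i <- r) h (Sz_x x y i ^+ f i) =
    \prod_(i <- r) Sz_x (h x) (h y) i ^+ f i.
  by apply: eq_bigr => i _; rewrite gmulfXn gmulf_Sz_x.
rewrite !prodE; congr [:: _, _ & _ ++ [:: _, _ & _]].
congr flatten; apply: eq_map => i /=.
by rewrite /Sz_R1_at !(gmulf_Sz_x, gmulf1, gmulfXn, gmulfV, gmulfR, gmulfM).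
Qed.

End SzRelationsMorphism.

(** * The matrices of Sz(q) *)

Section SuzukiField.
Local Open Scope ring_scope.
Variables (F : finFieldType) (m : nat) (hF : #|F| = Sz_q m).
Local Notation t := (Sz_t m).

Lemma Sz_two0 : 1 + 1 = 0 :> F.
Proof. exact: (pcharf0 (Sz_pchar hF)). Qed.

(** Makes [ring] usable in characteristic 2: the surplus 2k of one side over the other is supplied
    by hand. *)
Lemma Sz_eq2 (k u v : F) : v = u + (1 + 1) * k -> u = v.
Proof. by rewrite Sz_two0 mul0r addr0. Qed.

Lemma Sz_thetaD (a b : F) : (a + b) ^+ t = a ^+ t + b ^+ t.
Proof.
by apply: exprDn_pchar; rewrite pnatX pnatE // (Sz_pchar hF).
Qed.

(** As t^2 = 2q and a^q = a, raising to the power t is a square root of the Frobenius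
    automorphism. *)
Lemma Sz_thetaK (a : F) : (a ^+ t) ^+ t = a ^+ 2.
Proof.
have -> : (a ^+ t) ^+ t = (a ^+ Sz_q m) ^+ 2.
  rewrite -!exprM -expnSr -expnD; congr (a ^+ (2 ^ _)); lia.
by rewrite -hF expf_card.
Qed.

Lemma Sz_t_double : t = (t./2 + t./2)%N.
Proof. by rewrite addnn /Sz_t expnS mul2n doubleK. Qed.

End SuzukiField.

Section SuzukiMatrices.
Local Open Scope ring_scope.
Variables (F : finFieldType) (m : nat) (hF : #|F| = Sz_q m).
Local Notation t := (Sz_t m).

(** The entries (2, 1) and (3, 1) serve as coordinates; the remaining ones are functions of them
    chosen so that the set is closed under products. *)
Definition Sz_lower (a b : F) : 'M[F]_4 := mx4
  [:: [:: 1; 0; 0; 0];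
      [:: a; 1; 0; 0];
      [:: b; a ^+ t; 1; 0];
      [:: a ^+ 2 * a ^+ t + a * b + b ^+ t; a * a ^+ t + b; a; 1]].

Lemma Sz_lowerM a b c d :
  Sz_lower a b * Sz_lower c d = Sz_lower (a + c) (b + d + a ^+ t * c).
Proof.
have eq2 := Sz_eq2 hF.
apply/matrixP=> -[[|[|[|[|i]]]] Hi] [[|[|[|[|j]]]] Hj] //;
  rewrite !mxE !big_ord_recl big_ord0 !mxE /=; try ring;
  rewrite !(Sz_thetaD hF) ?exprMn ?(Sz_thetaK hF); try ring.
(* Entries (4, 1) and (4, 2) agree only in characteristic 2; twice the witness is the surplus of the
   right-hand side. *)
- apply: (eq2 (a ^+ 2 * c ^+ t + a * c * a ^+ t + a * c * c ^+ t +
               c ^+ 2 * a ^+ t)); ring.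
- apply: (eq2 (c * a ^+ t)); ring.
Qed.

Lemma Sz_lower00 : Sz_lower 0 0 = 1.
Proof.
have t0 : 0 ^+ t = 0 :> F by rewrite expr0n expn_eq0.
apply/matrixP=> -[[|[|[|[|i]]]] Hi] [[|[|[|[|j]]]] Hj] //;
  by rewrite !mxE /= ?t0; ring.
Qed.

Lemma Sz_xhatE : Sz_xhat F = Sz_lower 1 1.
Proof.
apply/matrixP=> -[[|[|[|[|i]]]] Hi] [[|[|[|[|j]]]] Hj] //;
  by rewrite !mxE /= ?expr1n ?mulr1 // -?addrA ?(Sz_two0 hF) ?addr0.
Qed.

(** Consecutive diagonal entries of [Sz_yhat] have ratios w, w^t and w, because t/2 + t/2 = t; so
    entry (2, 1) is scaled by w and entry (3, 1) by w^(t+1). *)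
Lemma Sz_lower_yhat (w a b : F) : w != 0 ->
  Sz_lower a b * Sz_yhat m w =
  Sz_yhat m w * Sz_lower (a * w) (b * w ^+ t.+1).
Proof.
move=> w0; rewrite [LHS]mul_mx_diag [RHS]mul_diag_mx.
set k := (t./2)%N; have tE : t = (k + k)%N by exact: Sz_t_double.
have wt : (w ^+ t.+1) ^+ t = w ^+ 2 * w ^+ t.
  by rewrite exprS exprMn (Sz_thetaK hF) mulrC.
have wk : w ^+ k != 0 by rewrite expf_neq0.
apply/matrixP=> -[[|[|[|[|i]]]] Hi] [[|[|[|[|j]]]] Hj] //;
  rewrite !mxE /= ?exprMn ?wt -/k ?exprS ?tE ?exprD ?expr0; field;
  by rewrite ?w0 ?wk.
Qed.

End SuzukiMatrices.

Section SuzukiGroup.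
Variables (F : finFieldType) (m : nat) (hF : #|F| = Sz_q m) (w : F).
Hypothesis w_prim : ((Sz_q m).-1.-primitive_root w)%R.
Local Notation t := (Sz_t m).
Local Notation q := (Sz_q m).
Local Notation N := (2 * m).+1.

Lemma Sz_q_gt1 : 1 < q.
Proof. exact: (ltn_exp2l 0). Qed.

Lemma Sz_w_neq0 : (w != 0)%R.
Proof.
rewrite -unitfE; apply/unitrP; exists (w ^+ q.-2)%R.
have e : (w ^+ q.-1 = 1)%R := prim_expr_order w_prim.
have [/eqP q1|q1] := boolP (q.-1 == 0); first by move: q1 Sz_q_gt1; clear; lia.
by rewrite -exprS -exprSr prednK ?e // lt0n.
Qed.
Local Notation w0 := Sz_w_neq0.

Lemma Sz_lower_unit a b : (Sz_lower m a b : 'M[F]_4) \is a GRing.unit.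
Proof.
apply/unitrP; exists (Sz_lower m a (b + a ^+ t * a))%R.
have dbl (u : F) : (u + u = 0)%R by exact: (addrr_pchar2 (Sz_pchar hF)).
split; rewrite (Sz_lowerM hF); first by rewrite -addrA !dbl Sz_lower00.
by rewrite addrA !dbl add0r dbl Sz_lower00.
Qed.

Definition lowerg (a b : F) : {'GL_4[F]} := FinRing.unit _ (Sz_lower_unit a b).
Definition toralg : {'GL_4[F]} := FinRing.unit _ (Sz_yhat_unit m w0).
Definition weylg : {'GL_4[F]} := FinRing.unit _ (Sz_zhat_unit F).

Lemma lowergM a b c d :
  lowerg a b * lowerg c d = (lowerg (a + c) (b + d + a ^+ t * c))%R.
Proof. exact/val_inj/(Sz_lowerM hF). Qed.

Lemma lowerg0 : lowerg 0%R 0%R = 1.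
Proof. exact/val_inj/Sz_lower00. Qed.

Lemma lowergV a b : (lowerg a b)^-1 = (lowerg a (b + a ^+ t * a))%R.
Proof.
apply: mulg1_eq; rewrite lowergM addrA (addrr_pchar2 (Sz_pchar hF)).
rewrite (addrr_pchar2 (Sz_pchar hF)) add0r.
by rewrite (addrr_pchar2 (Sz_pchar hF)) lowerg0.
Qed.

Lemma lowerg_inj a b c d : lowerg a b = lowerg c d -> a = c /\ b = d.
Proof.
move=> /(congr1 GLval) /matrixP E; split.
  by have := E (inord 1) (inord 0); rewrite !mxE !inordK.
by have := E (inord 2) (inord 0); rewrite !mxE !inordK.
Qed.

Lemma lowerg_sqr a b : (lowerg a b) ^+ 2 = (lowerg 0 (a ^+ t * a))%R.
Proof.
by rewrite expg2 lowergM !(addrr_pchar2 (Sz_pchar hF)) add0r.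
Qed.

Lemma lowergR a b c d :
  [~ lowerg a b, lowerg c d] = (lowerg 0 (a ^+ t * c + c ^+ t * a))%R.
Proof.
apply: (mulgI (lowerg c d * lowerg a b)); rewrite -commgC !lowergM.
congr lowerg; first by ring.
by apply: (Sz_eq2 hF (k := (c ^+ t * a)%R)); ring.
Qed.

Lemma lowergJ a b : lowerg a b ^ toralg = (lowerg (a * w) (b * w ^+ t.+1))%R.
Proof.
apply: (mulgI toralg); rewrite -conjgC.
exact/val_inj/(Sz_lower_yhat hF _ _ w0).
Qed.

Lemma lowergJz a b k :
  lowerg a b ^ expgz toralg k = (lowerg (a * w ^ k) (b * w ^ (k * t.+1%:Z)))%R.
Proof.
have J n a1 b1 : lowerg a1 b1 ^ (toralg ^+ n) =
    (lowerg (a1 * w ^+ n) (b1 * w ^+ (n * t.+1)))%R.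
  elim: n a1 b1 => [|n IHn] a1 b1; first by rewrite conjg1 mul0n !expr0 !mulr1.
  by rewrite expgS conjgM lowergJ IHn -!mulrA -!exprD -?exprS mulSn.
case: k => n /=; first by rewrite J -PoszM.
have e l : (w ^ (- l%:Z) * w ^+ l = 1)%R.
  by rewrite -exprnN mulVf ?expf_neq0 ?w0.
(* For a negative exponent both sides are conjugated back by the positive power, where [J]
   applies. *)
apply: (conjg_inj (toralg ^+ n.+1)); rewrite conjgKV J.
by rewrite NegzE mulNr -PoszM -!mulrA !e !mulr1.
Qed.

End SuzukiGroup.

(** If some bit were 1, the bits would be the coefficients of a nonzero polynomial over F_2 of
    degree below N with root [a], and the minimal polynomial, of degree N, would divide it. *)
Lemma minPoly_bits_free (L : fieldExtType 'F_2) (a : L) (N : nat)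
    (c f : nat -> bool) :
  minPoly 1%AS a = ('X^N + \sum_(1 <= i < N) (c i)%:R *: 'X^i + 1)%R ->
  0 < N ->
  (\sum_(0 <= i < N) (f i)%:R * a ^+ i = 0)%R ->
  forall i, i < N -> f i = false.
Proof.
move=> minE N0 fa i iN; apply/negbTE/negP => fi.
pose g : {poly L} := (\poly_(j < N) (f j)%:R)%R.
have g1 : g \is a polyOver 1%AS.
  by apply/polyOver_poly => j _; rewrite (rpred_nat (1%AS : {subfield L})).
have ga : root g a.
  by apply/rootP; rewrite horner_poly -[RHS]fa big_mkord.
have /dvdp_leq := minPoly_dvdp g1 ga.
have g0 : g != 0%R.
  apply/eqP => /polyP/(_ i); rewrite coef_poly iN fi coef0 => /eqP.
  by rewrite oner_eq0.
move=> /(_ g0); rewrite minE leqNgt => /negP; apply.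
have sgN : size g <= N by exact: size_poly.
apply: leq_ltn_trans sgN _.
rewrite -addrA size_polyDl ?size_polyXn //.
rewrite ltnS (leq_trans (size_polyD _ _)) // geq_max size_poly1 N0 andbT.
rewrite big_nat; elim/big_rec: _ => [|j s /andP[_ jN] sN].
  by rewrite size_poly0.
rewrite (leq_trans (size_polyD _ _)) // geq_max sN andbT.
by rewrite (leq_trans (size_scale_leq _ _)) // size_polyXn.
Qed.

Lemma minPoly_bits_root (L : fieldExtType 'F_2) (a : L) (N : nat) (c : nat -> bool) :
  minPoly 1%AS a = ('X^N + \sum_(1 <= i < N) (c i)%:R *: 'X^i + 1)%R ->
  (a ^+ N + \sum_(1 <= i < N) (c i)%:R * a ^+ i + 1 = 0)%R.
Proof.
move=> minE; have := minPolyxx 1%AS a; rewrite minE !hornerE; apply: etrans.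
congr (_ + _ + _)%R; rewrite horner_sum.
by apply: eq_bigr => i _; rewrite !hornerE.
Qed.

(** Trades the relator for an identity free of inverses, which can be compared entry by entry. *)
Lemma weyl_relationE (G : groupType) (x z : G) : z ^+ 2 = 1 ->
  x * z * x ^+ 2 = z * x * z -> x * z * x ^+ 2 * z * x^-1 * z = 1.
Proof.
rewrite expg2 => z2 ->.
by rewrite -(mulgA (z * x)) z2 mulg1 mulgK z2.
Qed.

(** * The defining relations in the matrix group *)

Section SuzukiRelations.
Variables (F : finFieldType) (m : nat) (hF : #|F| = Sz_q m) (w : F).
Hypothesis w_prim : ((Sz_q m).-1.-primitive_root w)%R.
Local Notation t := (Sz_t m).
Local Notation q := (Sz_q m).
Local Notation N := (2 * m).+1.
Local Notation X := (lowerg hF 1%R 1%R).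
Local Notation Y := (toralg w_prim).
Local Notation Z := (weylg F).

Lemma Sz_x_lowerg k : Sz_x X Y k = lowerg hF (w ^ k)%R (w ^ (k * t.+1%:Z))%R.
Proof. by rewrite /Sz_x lowergJz !mul1r. Qed.

Lemma lowerg_sqr_torus k :
  lowerg hF (w ^ k)%R (w ^ (k * t.+1%:Z))%R ^+ 2 = lowerg hF 0%R (w ^ (k * t.+1%:Z))%R.
Proof.
rewrite lowerg_sqr; congr lowerg.
by rewrite -exprSr exprnP exprz_exp.
Qed.

Lemma prim_expr_t2 : (w ^+ (t * t) = w ^+ 2)%R.
Proof. by rewrite exprM Sz_thetaK. Qed.

Lemma prod_sqr_lowerg (r : seq nat) (f : nat -> bool) :
  \prod_(i <- r) Sz_x X Y i%:Z ^+ (2 * f i) =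
  lowerg hF 0%R (\sum_(i <- r) (f i)%:R * w ^+ (i * (t + 1)))%R.
Proof.
elim: r => [|i r IHr]; first by rewrite !big_nil lowerg0.
rewrite !big_cons IHr expgnA Sz_x_lowerg lowerg_sqr_torus -PoszM addn1.
case: (f i); rewrite ?mul1r ?mul0r ?mul1g ?add0r // expg1 lowergM.
by congr lowerg; rewrite ?expr0n ?mulr0 ?addr0.
Qed.

(** Only the first coordinate is additive along the product; the second collects cross terms and
    stays unnamed. For the second relation of R_2 it is read off [Sz_phat] instead. *)
Lemma prod_lowerg (r : seq nat) (f : nat -> bool) :
  exists b, \prod_(i <- r) Sz_x X Y i%:Z ^+ f i =
  lowerg hF (\sum_(i <- r) (f i)%:R * w ^+ i)%R b.
Proof.
elim: r => [|i r [b IHr]]; first by exists 0%R; rewrite !big_nil lowerg0.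
rewrite !big_cons IHr Sz_x_lowerg.
case: (f i); rewrite ?mul1r ?mul0r ?mul1g ?add0r //; last by exists b.
by rewrite expg1 lowergM; eexists.
Qed.

Lemma expr_diag_mx (R : comNzRingType) (n : nat) (v : 'rV[R]_n.+1) k :
  (diag_mx v ^+ k = diag_mx (map_mx (fun a => a ^+ k) v))%R.
Proof.
elim: k => [|k IHk].
  by apply/matrixP=> i j; rewrite !mxE expr0; case: eqP.
rewrite exprS IHk [LHS]mulmx_diag; congr diag_mx.
by apply/rowP=> j; rewrite !mxE exprS.
Qed.

Lemma toralgX_row k :
  GLval (Y ^+ k) = diag_mx (\row_(j < 4) (nth 0 [:: w ^+ t./2.+1; w ^+ t./2;
      w ^- t./2; w ^- t./2.+1] j ^+ k))%R.
Proof.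
rewrite [LHS]FinRing.val_unitX [LHS]expr_diag_mx; congr diag_mx.
by apply/rowP=> j; rewrite !mxE.
Qed.

Lemma toralg_order : Y ^+ (q - 1) = 1.
Proof.
have w1 : (w ^+ (q - 1) = 1)%R by rewrite subn1 (prim_expr_order w_prim).
apply/val_inj; rewrite [LHS]toralgX_row; apply/matrixP=> i j; rewrite !mxE.
case: (i == j); rewrite ?mulr0n // !mulr1n.
have e k : ((w ^+ k) ^+ (q - 1) = 1)%R by rewrite exprAC w1 expr1n.
by case: i => [[|[|[|[|i]]]] Hi] //=; rewrite ?exprVn e ?invr1.
Qed.

Lemma weylg_order : Z ^+ 2 = 1.
Proof.
apply/val_inj/matrixP=> -[[|[|[|[|i]]]] Hi] [[|[|[|[|j]]]] Hj] //;
  by rewrite !mxE !big_ord_recl big_ord0 !mxE /=; ring.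
Qed.

Lemma toralg_weylg_order : (Y * Z) ^+ 2 = 1.
Proof.
have -> : (Y * Z) ^+ 2 = Y * (Z * (Y * Z)) by rewrite expg2 !mulgA.
have wk k : (w ^+ k != 0)%R by rewrite expf_neq0 ?(Sz_w_neq0 w_prim).
apply/val_inj; rewrite /= [(Sz_yhat _ _ * _)%R]mul_diag_mx.
have -> : (Sz_yhat m w * Sz_zhat F)%R = mx4
   [:: [:: 0; 0; 0; w ^+ t./2.+1]; [:: 0; 0; w ^+ t./2; 0];
       [:: 0; w ^- t./2; 0; 0]; [:: w ^- t./2.+1; 0; 0; 0]]%R.
  rewrite [LHS]mul_diag_mx.
  apply/matrixP=> -[[|[|[|[|i]]]] Hi] [[|[|[|[|j]]]] Hj] //;
    by rewrite !mxE /= ?mulr0 ?mulr1.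
apply/matrixP=> -[[|[|[|[|i]]]] Hi] [[|[|[|[|j]]]] Hj] //;
  rewrite !mxE !big_ord_recl big_ord0 !mxE /= ?(mulr0, mul0r, mul1r, addr0, add0r) //;
  by rewrite ?divff ?mulVf ?wk.
Qed.

Lemma weylg_identity : X * Z * X ^+ 2 * Z * X^-1 * Z = 1.
Proof.
apply: (weyl_relationE weylg_order).
have two0 := Sz_two0 hF.
have XZ : (Sz_xhat F * Sz_zhat F = mx4
   [:: [:: 0; 0; 0; 1]; [:: 0; 0; 1; 1]; [:: 0; 1; 1; 1]; [:: 1; 1; 0; 1]])%R.
  apply/matrixP=> -[[|[|[|[|i]]]] Hi] [[|[|[|[|j]]]] Hj] //;
  by rewrite !mxE !big_ord_recl big_ord0 !mxE /= ?(mulr0, mul0r, mul1r, addr0, add0r).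
have XX : (Sz_xhat F * Sz_xhat F = mx4
   [:: [:: 1; 0; 0; 0]; [:: 0; 1; 0; 0]; [:: 1; 0; 1; 0]; [:: 1; 1; 0; 1]])%R.
  apply/matrixP=> -[[|[|[|[|i]]]] Hi] [[|[|[|[|j]]]] Hj] //;
  by rewrite !mxE !big_ord_recl big_ord0 !mxE /=
    ?(mulr0, mul0r, mul1r, addr0, add0r, two0).
have ZXZ : (Sz_zhat F * (Sz_xhat F * Sz_zhat F) = mx4
   [:: [:: 1; 1; 0; 1]; [:: 0; 1; 1; 1]; [:: 0; 0; 1; 1]; [:: 0; 0; 0; 1]])%R.
  rewrite XZ; apply/matrixP=> -[[|[|[|[|i]]]] Hi] [[|[|[|[|j]]]] Hj] //;
  by rewrite !mxE !big_ord_recl big_ord0 !mxE /=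
    ?(mulr0, mul0r, mul1r, addr0, add0r, two0).
rewrite -(mulgA Z).
apply/val_inj; rewrite /= -(Sz_xhatE hF) ZXZ XX XZ.
apply/matrixP=> -[[|[|[|[|i]]]] Hi] [[|[|[|[|j]]]] Hj] //;
  by rewrite !mxE !big_ord_recl big_ord0 !mxE /=
    ?(mulr0, mul0r, mul1r, addr0, add0r, two0).
Qed.

(** The commutator of x_0 and x_i becomes S(0, w^i + w^(it)). Modulo q - 1 one has (t - 1)(t + 1) =
    1 and (2 - t)(t + 1) = t, so the two summands come from the squares of x_(i(t-1)) and
    x_(i(2-t)). *)
Lemma Sz_R1_lowerg (i : nat) : relations_hold (Sz_R1_at m X Y i).
Proof.
have w0 := Sz_w_neq0 w_prim.
have wi k : (w ^ (k%:Z * i%:Z) = w ^+ (k * i))%R by rewrite -PoszM.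
have wi0 k : (w ^+ k != 0)%R by rewrite expf_neq0.
have wt : (w ^+ (t * t * i) = w ^+ i * w ^+ i)%R.
  by rewrite exprM prim_expr_t2 -exprM mul2n -addnn exprD.
have wt1 : (w ^ (i%:Z * (t%:Z - 1) * t.+1%:Z) = w ^+ i)%R.
  have -> : (i%:Z * (t%:Z - 1) * t.+1%:Z = (t * t)%N%:Z * i%:Z + - i%:Z)%R.
    by rewrite PoszM -addn1 PoszD; ring.
  by rewrite expfzDr // wi wt -exprnN mulfK.
have wt2 : (w ^ (i%:Z * (2%:Z - t%:Z) * t.+1%:Z) = (w ^+ i) ^+ t)%R.
  have -> : (i%:Z * (2%:Z - t%:Z) * t.+1%:Z =
     (t + 2)%N%:Z * i%:Z + - (t * t)%N%:Z * i%:Z)%R.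
    by rewrite PoszM -addn1 !PoszD; ring.
  rewrite expfzDr // wi mulNr -PoszM -exprnN wt mulnDl exprD mul2n -addnn exprD.
  by rewrite mulfK ?mulf_neq0 // mulnC exprM.
rewrite /relations_hold /Sz_R1_at /= !Sz_x_lowerg !mul0r !expr0z.
rewrite !lowerg_sqr_torus lowerg_sqr !lowergR lowergM wt1 wt2.
have t0 : (0 ^+ t = 0 :> F)%R by rewrite expr0n expn_eq0.
rewrite t0 !mulr0 !mul0r !expr1n !mul1r !mulr1 !addr0 lowerg0 eqxx.
by rewrite divg_eq1 eqxx.
Qed.


Variables c d e : nat -> bool.
Hypothesis consts : Sz_constants hF w c d e.
Local Notation L := (pPrimeCharType (Sz_pchar hF) : fieldExtType 'F_2).

Lemma Sz_bits_free (f : nat -> bool) :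
  (\sum_(0 <= i < N) (f i)%:R * w ^+ i = 0)%R -> forall i, i < N -> f i = false.
Proof. by case: consts => _ dE _; apply: (minPoly_bits_free (L := L) dE). Qed.

Lemma Sz_bits_free_theta (f : nat -> bool) :
  (\sum_(0 <= i < N) (f i)%:R * w ^+ (i * (t + 1)) = 0)%R ->
  forall i, i < N -> f i = false.
Proof.
case: consts => cE _ _ f0; apply: (minPoly_bits_free (L := L) cE) => //.
apply: etrans f0; apply: eq_bigr => i _.
by rewrite mulnC exprM addnC.
Qed.

Lemma Sz_phatE :
  GLval (Sz_x X Y N%:Z *
   \prod_(i <- rev (index_iota 1 N)) Sz_x X Y i%:Z ^+ d i * Sz_x X Y 0) =
  Sz_phat m w d.
Proof.
have xE (i : nat) : GLval (Sz_x X Y i%:Z) = Sz_xhat_ m w i.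
  rewrite /Sz_x conjgE mulgA 2!GL_ME GL_VE /Sz_xhat_; congr (_ * _ * _)%R.
  - by rewrite FinRing.val_unitX.
  - by rewrite (Sz_xhatE hF).
  - by rewrite FinRing.val_unitX.
rewrite 2!GL_ME /Sz_phat !xE; congr (_ * _ * _)%R.
elim: (rev _) => [|i r IHr]; first by rewrite !big_nil.
rewrite !big_cons -IHr GL_ME -xE; congr (_ * _)%R.
exact: FinRing.val_unitX.
Qed.

(** The first relator expresses that w^(1+t) is a root of its minimal polynomial. In the second
    relation the minimal polynomial of w annihilates the first coordinate of the left side, which is
    therefore S(0, b) with b the (3, 1) entry of [Sz_phat]; the expansion of b defines [e]. *)
Lemma Sz_R2_lowerg : relations_hold (Sz_R2 m c d e X Y).
Proof.
have revE (g : nat -> F) k : (\sum_(i <- rev (index_iota k N)) g i =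
    \sum_(k <= i < N) g i)%R by rewrite (perm_big (index_iota k N)) ?perm_rev.
case: (consts) => cE dE eE; rewrite /relations_hold /= andbT; apply/andP; split.
  rewrite prod_sqr_lowerg !Sz_x_lowerg !lowerg_sqr_torus !lowergM revE.
  rewrite mul0r expr0z !mulr0 !addr0 -(lowerg0 hF); apply/eqP; congr lowerg.
  apply: etrans (minPoly_bits_root (L := L) cE).
  rewrite -PoszM (mulnC N) -exprnP exprM add1n.
  congr (_ + _ + _)%R; apply: eq_bigr => i _.
  by rewrite addn1 mulnC exprM.
rewrite prod_sqr_lowerg revE -eE.
have [b pE] := prod_lowerg (rev (index_iota 1 N)) d.
have := Sz_phatE; rewrite pE !Sz_x_lowerg !lowergM revE !mul0r !expr0z.
have -> : (w ^ (N%:Z) + \sum_(1 <= i < N) (d i)%:R * w ^+ i + 1 = 0)%R.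
  exact: (minPoly_bits_root (L := L) dE).
by move=> <-; apply/eqP; congr lowerg; rewrite /= !mxE !inordK.
Qed.

Lemma Sz_relations_lowerg : relations_hold (Sz_relations m c d e X Y Z).
Proof.
have X4 : X ^+ 4 = 1.
  by rewrite (expgnA _ 2 2) !lowerg_sqr mulr0 lowerg0.
rewrite /relations_hold /Sz_relations /= X4 toralg_order weylg_order.
rewrite toralg_weylg_order weylg_identity !eqxx /=.
rewrite all_cat; apply/andP; split; last first.
  by have := Sz_R2_lowerg; rewrite /relations_hold /= !eqxx !andbT.
apply/allP=> r /flattenP[s /mapP[i _ ->]] rs.
by have /allP/(_ r rs) := Sz_R1_lowerg i.
Qed.

End SuzukiRelations.

(** * The Borel subgroup of the presented group *)

Lemma prodg_delta (G : groupType) (f : nat -> G) n j : j < n ->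
  \prod_(0 <= i < n) f i ^+ (i == j) = f j.
Proof.
move=> jn; rewrite (big_cat_nat (n := j)) ?(ltnW jn) //=.
rewrite [X in _ * X]big_ltn // eqxx expg1.
rewrite [X in X * _]big1_seq ?mul1g => [|i]; last first.
  by rewrite mem_index_iota => /andP[_ /andP[_ ij]]; rewrite ltn_eqF.
rewrite [X in _ * X]big1_seq ?mulg1 // => i.
by rewrite mem_index_iota => /andP[_ /andP[ij _]]; rewrite gtn_eqF.
Qed.

Lemma expgz_nat (G : groupType) (g : G) n k : g ^+ n = 1 -> 0 < n ->
  exists j : nat, expgz g k = g ^+ j.
Proof.
move=> gn n0; case: k => k; first by exists k.
exists (k.+1 * n.-1)%N => /=; apply: mulg1_eq.
by rewrite -expgnDr -mulnS prednK // mulnC expgnA gn expg1n.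
Qed.

Lemma commuteJ (G : groupType) (a b g : G) :
  commute a b -> commute (a ^ g) (b ^ g).
Proof. by move=> ab; rewrite /commute -!conjMg ab. Qed.

Section SzBorel.
Variables (m : nat) (c d e : nat -> bool) (G : groupType) (x y z : G).
Hypothesis rels : relations_hold (Sz_relations m c d e x y z).
Local Notation q := (Sz_q m).
Local Notation N := (2 * m).+1.

(** Natural indices suffice, since y^(q-1) = 1 brings every integer index to this form. *)
Definition xconj (i : nat) : G := x ^ (y ^+ i).

Lemma Sz_x_xconj (i : nat) : Sz_x x y i%:Z = xconj i. Proof. by []. Qed.

Lemma Sz_relationsP :
  [/\ x ^+ 4 = 1, y ^+ (q - 1) = 1, relations_hold (Sz_R1 m x y),
      relations_hold (Sz_R2 m c d e x y) &
      [/\ z ^+ 2 = 1, (y * z) ^+ 2 = 1 & x * z * x ^+ 2 * z * x^-1 * z = 1]].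
Proof.
move: rels; rewrite /relations_hold /Sz_relations !all_cat.
case/and4P=> /and3P[/eqP ? /eqP ? _] ? ? /and4P[/eqP ? /eqP ? /eqP ? _].
by [].
Qed.

Lemma Sz_rel_x4 : x ^+ 4 = 1. Proof. by have [] := Sz_relationsP. Qed.

Lemma Sz_rel_yq : y ^+ (q - 1) = 1. Proof. by have [] := Sz_relationsP. Qed.

Lemma Sz_rel_zV : z^-1 = z.
Proof. by have [_ _ _ _ [z2 _ _]] := Sz_relationsP; apply: mulg1_eq. Qed.

Lemma Sz_rel_yz : y ^ z = y^-1.
Proof.
have [_ _ _ _ [_ yz _]] := Sz_relationsP; apply/esym/mulg1_eq.
by rewrite conjgE Sz_rel_zV -[RHS]yz expg2 !mulgA.
Qed.

(** The last relator solved for z x^2 z; in this form it puts the conjugate of a square by z into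
    BzB. *)
Lemma Sz_rel_x2 : x ^+ 2 ^ z = x^-1 * z * x.
Proof.
have [_ _ _ _ [_ _]] := Sz_relationsP; rewrite conjgE Sz_rel_zV.
move: (x ^+ 2) => s xz; apply: (mulgI x); apply: (mulIg (x^-1 * z)).
by rewrite !mulgA xz mulgV mul1g mulgK -{2}Sz_rel_zV mulgV.
Qed.

(** The indices i(t-1) and i(2-t) are forgotten: in the abstract group it is enough that the
    commutator is a product of two squares. *)
Lemma Sz_rel_R1 i : 0 < i < N ->
  commute (x ^+ 2) (xconj i) /\
  exists k l, [~ x, xconj i] = xconj k ^+ 2 * xconj l ^+ 2.
Proof.
move=> iN; have [_ _ /allP R1 _ _] := Sz_relationsP.
have xz k : exists j, Sz_x x y k = xconj j.
  rewrite /Sz_x; case: (@expgz_nat _ y (q - 1) k).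
  - exact: Sz_rel_yq.
  - by rewrite subn_gt0 Sz_q_gt1.
  by move=> j ->; exists j.
have R1i (r : G * G) : r \in Sz_R1_at m x y i -> r.1 == r.2.
  move=> ri; apply: (R1 r); apply/flattenP; exists (Sz_R1_at m x y i) => //.
  by apply/mapP; exists i; rewrite ?mem_index_iota.
split.
  apply/commgP; have := R1i _ (mem_head _ _).
  by rewrite /= Sz_x_xconj [Sz_x _ _ _]conjg1.
have [k kE] := xz (i%:Z * ((Sz_t m)%:Z - 1))%R.
have [l lE] := xz (i%:Z * (2%:Z - (Sz_t m)%:Z))%R.
have /R1i /= : ([~ Sz_x x y 0, Sz_x x y i%:Z] *
    (xconj k ^+ 2 * xconj l ^+ 2)^-1, 1) \in Sz_R1_at m x y i.
  by rewrite /Sz_R1_at kE lE !inE eqxx orbT.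
rewrite divg_eq1 {1}[Sz_x _ _ _]conjg1 => /eqP R.
by exists k, l.
Qed.

Lemma Sz_rel_R2 :
  xconj N ^+ 2 * \prod_(i <- rev (index_iota 1 N)) xconj i ^+ (2 * c i) * x ^+ 2 = 1
  /\
  xconj N * \prod_(i <- rev (index_iota 1 N)) xconj i ^+ d i * x =
  \prod_(i <- rev (index_iota 0 N)) xconj i ^+ (2 * e i).
Proof.
have [_ _ _ /and3P[/eqP /= R2a /eqP /= R2b _] _] := Sz_relationsP.
by move: R2a R2b; rewrite [Sz_x _ _ 0]conjg1.
Qed.

(** * The central subgroup spanned by the squares *)

Lemma xconjJ i j : xconj i ^ (y ^+ j) = xconj (i + j).
Proof. by rewrite /xconj -conjgM expgnDr. Qed.

Lemma xconj_period i k : xconj (i + k * (q - 1)) = xconj i.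
Proof. by rewrite /xconj mulnC expgnDr expgnA Sz_rel_yq expg1n mulg1. Qed.

(** A relator of R_1 shifted by y^j. It reaches only the window of length N starting at j;
    [squares_central] lifts this restriction. *)
Lemma xconj_sqr_commute j k : j <= k < j + N -> commute (xconj j ^+ 2) (xconj k).
Proof.
move=> /andP[jk kN]; have [->|jk'] := eqVneq k j.
  exact/commute_sym/commuteX/commute_refl.
rewrite -(subnK jk) -{1}(add0n j) -!xconjJ -conjXg; apply: commuteJ.
rewrite [xconj 0]conjg1; apply: (Sz_rel_R1 _).1; lia.
Qed.

Lemma xconj_sqr_sqr j : xconj j ^+ 2 * xconj j ^+ 2 = 1.
Proof. by rewrite -expg2 -expgnA -conjXg Sz_rel_x4 conj1g. Qed.

(** The order and the range of the factors are fixed, so that the exponents can later be recovered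
    from the linear independence of the w^(i(t+1)). *)
Definition squares (v : G) : Prop :=
  exists b : nat -> bool, v = \prod_(0 <= i < N) (xconj i ^+ 2) ^+ b i.

Lemma squares1 : squares 1.
Proof. by exists (fun=> false); rewrite big1. Qed.

Lemma squares_xconj j : j < N -> squares (xconj j ^+ 2).
Proof.
by move=> jN; exists (eq_op^~ j); rewrite (prodg_delta (fun i => xconj i ^+ 2)).
Qed.

Lemma squares_commute_window i j : i < N -> j < N ->
  commute (xconj i ^+ 2) (xconj j ^+ 2).
Proof.
move=> iN jN; have [ij|/ltnW ji] := leqP i j.
  by apply: commuteX; apply: xconj_sqr_commute; lia.
by apply: commute_sym; apply: commuteX; apply: xconj_sqr_commute; lia.
Qed.

Lemma squaresM u v : squares u -> squares v -> squares (u * v).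
Proof.
move=> [a ->] [b ->]; exists (fun i => a i (+) b i).
rewrite [X in X * _]big_seq [X in _ * X]big_seq -prodgM_commute => [|i j]; last first.
  rewrite !mem_index_iota => /andP[_ iN] /andP[_ jN].
  by apply/commuteX2/squares_commute_window.
rewrite -big_seq; apply: eq_bigr => i _.
by case: (a i) (b i) => -[]; rewrite ?expg1 ?mulg1 ?mul1g ?xconj_sqr_sqr.
Qed.

Lemma squaresV u : squares u -> u^-1 = u.
Proof.
move=> [a ->]; apply: mulg1_eq; rewrite [X in X * _]big_seq [X in _ * X]big_seq.
rewrite -prodgM_commute => [|i j]; last first.
  rewrite !mem_index_iota => /andP[_ iN] /andP[_ jN].
  by apply/commuteX2/squares_commute_window.
by rewrite big1 // => i _; case: (a i); rewrite ?expg1 ?mulg1 ?xconj_sqr_sqr.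
Qed.

Lemma squares_prod (r : seq nat) (f : nat -> G) :
  (forall i, i \in r -> squares (f i)) -> squares (\prod_(i <- r) f i).
Proof.
move=> rf; rewrite big_seq; apply: big_ind => //; first exact: squares1.
exact: squaresM.
Qed.

Lemma squaresX u (b : bool) : squares u -> squares (u ^+ b).
Proof. by case: b => // _; apply: squares1. Qed.

(** The first relator of R_2 solved for x_N^2; this closes the span under conjugation by y. *)
Lemma squares_xconjN : squares (xconj N ^+ 2).
Proof.
have [R2a _] := Sz_rel_R2.
have -> : xconj N ^+ 2 =
    (\prod_(i <- rev (index_iota 1 N)) xconj i ^+ (2 * c i) * x ^+ 2)^-1.
  by apply/esym/invg_inj; rewrite invgK; apply/esym/mulg1_eq; rewrite mulgA.
suff sq : squares (\prod_(i <- rev (index_iota 1 N)) xconj i ^+ (2 * c i) * x ^+ 2).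
  by rewrite squaresV.
apply: squaresM; last first.
  by have := squares_xconj (ltn0Sn (2 * m)); rewrite [xconj 0]conjg1.
apply: squares_prod => i; rewrite mem_rev mem_index_iota => /andP[_ iN].
by rewrite expgnA; apply/squaresX/squares_xconj.
Qed.


Lemma squaresJ u : squares u -> squares (u ^ y).
Proof.
move=> [a ->]; rewrite conjg_prod; apply: squares_prod => i.
rewrite mem_index_iota => /andP[_ iN]; rewrite conjXg; apply: squaresX.
rewrite conjXg (xconjJ i 1) addn1; move: iN; rewrite leq_eqVlt => /orP[/eqP[->]|iN].
  exact: squares_xconjN.
exact: squares_xconj.
Qed.

Lemma squares_xconj_all k : squares (xconj k ^+ 2).
Proof.
elim: k => [|k IHk]; first exact: squares_xconj.
by rewrite -addn1 -xconjJ -conjXg; apply: squaresJ.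
Qed.

(** The index 2m lies in the window of every i <= 2m, so x_2m commutes with the whole span;
    conjugation by a power of y, which preserves the span, carries this to every x_k. *)
Lemma squares_central k v : squares v -> commute (xconj k) v.
Proof.
have xm u : squares u -> commute (xconj (2 * m)) u.
  move=> [b ->]; rewrite big_seq; apply: commute_prod => i.
  rewrite mem_index_iota => /andP[_ iN].
  by apply/commuteX/commute_sym/xconj_sqr_commute; lia.
move=> sv; have [b ->] := sv; apply: commute_prod => i _; apply: commuteX.
(* Here l is k - 2m modulo q - 1, so y^l carries x_2m to x_k; the factor q - 2 stands for -1 among
   the natural numbers. *)
pose l := (k + 2 * m * (q - 2))%N.
have q1 : 1 < q := Sz_q_gt1 m.
have -> : xconj k = xconj (2 * m) ^ (y ^+ l).
  rewrite xconjJ -(xconj_period k (2 * m)); congr xconj; rewrite /l.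
  have -> : q - 1 = (q - 2).+1 by lia.
  rewrite mulnS; lia.
have -> : xconj i = xconj (i + l * (q - 2)) ^ (y ^+ l).
  rewrite xconjJ -(xconj_period i l); congr xconj.
  have -> : q - 1 = (q - 2).+1 by lia.
  rewrite mulnS; lia.
by rewrite -conjXg; apply/commuteJ/xm/squares_xconj_all.
Qed.

Lemma commg_squares i j : i < N -> j < N -> squares [~ xconj i, xconj j].
Proof.
suff up k l : k < l -> l < N -> squares [~ xconj k, xconj l].
  move=> iN jN; case: (ltngtP i j) => [ij|ji|->]; first exact: up.
    by rewrite -invgR squaresV; apply: up.
  by rewrite commgg; apply: squares1.
move=> kl lN; have [|_ [a [b abE]]] := @Sz_rel_R1 (l - k); first lia.
rewrite -(subnK (ltnW kl)) -{1}(add0n k) -!xconjJ -conjRg [xconj 0]conjg1 abE.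
by rewrite conjMg !conjXg !xconjJ; apply: squaresM; apply: squares_xconj_all.
Qed.

(** * Normal forms and the unipotent radical *)

Definition normal_form (u : G) : Prop := exists a v,
  squares v /\ u = \prod_(0 <= i < N) xconj i ^+ nat_of_bool (a i) * v.

Lemma normal_form1 : normal_form 1.
Proof.
by exists (fun=> false), 1; rewrite big1 // mulg1; split=> //; apply: squares1.
Qed.

Lemma normal_form_squares u v : normal_form u -> squares v -> normal_form (u * v).
Proof.
move=> [a [s [sq ->]]] sv; exists a, (s * v); rewrite mulgA; split=> //.
exact: squaresM.
Qed.

(** Collection: x_j moves left past the x_n with n > j, each time leaving a commutator in the
    central span, until it reaches its place. There the bit flips, and a repeated x_j contributes
    its square. *)
Lemma normal_form_xconj u j : j < N -> normal_form u -> normal_form (u * xconj j).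
Proof.
move=> jN [a [s [ss ->]]].
suff step n : j < n -> n <= N -> exists b v, squares v /\
    \prod_(0 <= i < n) xconj i ^+ nat_of_bool (a i) * xconj j =
    \prod_(0 <= i < n) xconj i ^+ nat_of_bool (b i) * v.
  have [b [v [sv E]]] := step N jN (leqnn N).
  exists b, (v * s); split; first exact: squaresM.
  by rewrite -mulgA -(squares_central j ss) mulgA E mulgA.
elim: n => // n IHn; rewrite ltnS leq_eqVlt => /orP[/eqP-> _|jn nN].
  pose b i := if i == n then ~~ a n else a i.
  exists b, (if a n then xconj n ^+ 2 else 1); split.
    by case: (a n); [apply: squares_xconj_all | apply: squares1].
  rewrite !big_nat_recr //= -!mulgA.
  have -> : \prod_(0 <= i < n) xconj i ^+ b i = \prod_(0 <= i < n) xconj i ^+ a i.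
    by apply: eq_big_nat => i /andP[_ ilt]; rewrite /b ltn_eqF.
  by rewrite /b eqxx; case: (a n); rewrite /= ?expg1 ?mul1g ?mulg1.
have [b [v [sv E]]] := IHn jn (ltnW nN).
pose b' i := if i == n then a n else b i.
exists b', (v * [~ xconj n ^+ a n, xconj j]); split.
  apply: squaresM => //; case: (a n); rewrite ?expg1 ?comm1g; last exact: squares1.
  by apply: commg_squares => //; apply: ltn_trans nN.
rewrite !big_nat_recr //= /b' eqxx.
have -> : \prod_(0 <= i < n) xconj i ^+ b' i = \prod_(0 <= i < n) xconj i ^+ b i.
  by apply: eq_big_nat => i /andP[_ ilt]; rewrite /b' ltn_eqF.
rewrite -mulgA (commgC (xconj n ^+ a n)); move: [~ _, _] => C.
have nv : commute (xconj n ^+ a n) v.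
  by apply: commute_sym; apply: commuteX; apply: commute_sym; apply: squares_central.
move: (xconj j) (xconj n ^+ a n) nv E => X A nv E.
by rewrite -(mulgA _ _ (v * C)) (mulgA _ v C) nv !mulgA E.
Qed.

(* The stabiliser of the normal forms under right multiplication: this presents
   them as a group, the unipotent radical. *)
Definition unip (g : G) : Prop :=
  forall u, (normal_form u -> normal_form (u * g)) /\
            (normal_form u -> normal_form (u * g^-1)).

Lemma unip1 : unip 1.
Proof. by move=> u; rewrite invg1 mulg1. Qed.

Lemma unipM g h : unip g -> unip h -> unip (g * h).
Proof.
move=> Ug Uh u; rewrite invMg !mulgA.
by split=> nu; [apply/(Uh _).1/(Ug _).1 | apply/(Ug _).2/(Uh _).2].
Qed.

Lemma unipV g : unip g -> unip g^-1.
Proof. by move=> Ug u; rewrite invgK; split; apply Ug. Qed.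

Lemma unip_prod (I : eqType) (r : seq I) (f : I -> G) :
  (forall i, i \in r -> unip (f i)) -> unip (\prod_(i <- r) f i).
Proof.
by move=> rf; rewrite big_seq; apply: big_ind => //; [apply: unip1|apply: unipM].
Qed.

Lemma unip_squares v : squares v -> unip v.
Proof.
by move=> sv u; rewrite (squaresV sv); split=> nu; apply: normal_form_squares.
Qed.

Lemma unip_xconj j : j < N -> unip (xconj j).
Proof.
move=> jN u; split=> nu; first exact: normal_form_xconj.
have -> : (xconj j)^-1 = xconj j * xconj j ^+ 2.
  by apply: mulg1_eq; rewrite -[LHS]/(xconj j ^+ 4) -conjXg Sz_rel_x4 conj1g.
rewrite mulgA; apply: normal_form_squares (squares_xconj_all j).
exact: normal_form_xconj.
Qed.

Lemma unipX g (b : bool) : unip g -> unip (g ^+ b).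
Proof. by case: b => // _; apply: unip1. Qed.

Lemma unipP g : unip g <-> normal_form g.
Proof.
split=> [Ug|[a [v [sv ->]]]]; first by rewrite -[g]mul1g; apply/(Ug _).1/normal_form1.
apply: unipM (unip_squares sv); apply: unip_prod => i.
by rewrite mem_index_iota => /andP[_ iN]; apply/unipX/unip_xconj.
Qed.

(** The second relation of R_2 solved for x_N; this makes the unipotent radical stable under y. *)
Lemma unip_xconjN : unip (xconj N).
Proof.
have [_ R2b] := Sz_rel_R2.
have x0 : unip x by have := unip_xconj (ltn0Sn (2 * m)); rewrite [xconj 0]conjg1.
set g := \prod_(i <- _) _ in R2b.
have Ug : unip g.
  apply: unip_prod => i; rewrite mem_rev mem_index_iota => /andP[_ iN].
  exact/unipX/unip_xconj.
have -> : xconj N = \prod_(i <- rev (index_iota 0 N)) xconj i ^+ (2 * e i) * (g * x)^-1.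
  by apply: (mulIg (g * x)); rewrite mulgVK -R2b; apply: mulgA.
apply: unipM; last exact/unipV/unipM.
apply: unip_prod => i; rewrite mem_rev mem_index_iota => /andP[_ iN].
by rewrite expgnA; apply/unipX/unip_squares/squares_xconj.
Qed.

Lemma unipJ u : unip u -> unip (u ^ y).
Proof.
move=> /unipP[a [v [sv ->]]]; rewrite conjMg.
apply: unipM; last exact/unip_squares/squaresJ.
rewrite conjg_prod; apply: unip_prod => i.
rewrite mem_index_iota => /andP[_ iN]; rewrite conjXg; apply: unipX.
rewrite (xconjJ i 1) addn1; move: iN; rewrite leq_eqVlt => /orP[/eqP[->]|iN].
  exact: unip_xconjN.
exact: unip_xconj.
Qed.

Lemma unipJX u k : unip u -> unip (u ^ (y ^+ k)).
Proof.
move=> Uu; elim: k => [|k IHk]; first by rewrite conjg1.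
by rewrite expgSr conjgM; apply: unipJ.
Qed.

Lemma unip_xconj_all k : unip (xconj k).
Proof. by rewrite -(add0n k) -xconjJ; apply/unipJX/unip_xconj. Qed.

Definition borel (g : G) : Prop := exists k u, unip u /\ g = y ^+ k * u.

Lemma y_pow_inv k : exists l, y ^- k = y ^+ l.
Proof.
case: (@expgz_nat _ y (q - 1) (- k%:Z)) => [|| j jE].
- exact: Sz_rel_yq.
- by rewrite subn_gt0 Sz_q_gt1.
by exists j; rewrite -jE; case: k {jE} => [|k] /=; rewrite ?invg1.
Qed.

Lemma borel_unip u : unip u -> borel u.
Proof. by move=> Uu; exists 0, u; rewrite mul1g. Qed.

Lemma borel_y k : borel (y ^+ k).
Proof. by exists k, 1; rewrite mulg1; split=> //; apply: unip1. Qed.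

Lemma borelM g h : borel g -> borel h -> borel (g * h).
Proof.
move=> [k [u [Uu ->]]] [l [v [Uv ->]]]; exists (k + l), (u ^ (y ^+ l) * v); split.
  by apply: unipM => //; apply: unipJX.
rewrite expgnDr; move: (y ^+ k) (y ^+ l) => a b.
by rewrite /conjg !mulgA mulgK.
Qed.

Lemma borelV g : borel g -> borel g^-1.
Proof.
move=> [k [u [Uu ->]]]; rewrite invMg; have [l ->] := y_pow_inv k.
by apply: borelM; [apply/borel_unip/unipV|apply: borel_y].
Qed.

Lemma borel_yV k : borel (y ^- k).
Proof. exact/borelV/borel_y. Qed.

Lemma yJz k : (y ^+ k) ^ z = y ^- k.
Proof. by rewrite conjXg Sz_rel_yz expVgn. Qed.

End SzBorel.

(** * Bruhat decomposition and the isomorphism *)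

Section SzKernel.
Variables (F : finFieldType) (m : nat) (hF : #|F| = Sz_q m) (w : F).
Hypothesis w_prim : ((Sz_q m).-1.-primitive_root w)%R.
Variables c d e : nat -> bool.
Hypothesis consts : Sz_constants hF w c d e.
Local Notation t := (Sz_t m).
Local Notation q := (Sz_q m).
Local Notation N := (2 * m).+1.
Variables (G : groupType) (x y z : G).
Hypothesis rels : relations_hold (Sz_relations m c d e x y z).
Variable psi : UMagmaMorphism.type G {'GL_4[F]}.
Hypothesis psi_x : psi x = lowerg hF 1%R 1%R.
Hypothesis psi_y : psi y = toralg w_prim.
Hypothesis psi_z : psi z = weylg F.
Local Notation xconj := (xconj x y).
Local Notation squares := (squares m x y).
Local Notation unip := (unip m x y).
Local Notation borel := (borel m x y).

Lemma psi_xconj i : psi (xconj i) = lowerg hF (w ^+ i)%R (w ^+ (i * t.+1))%R.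
Proof.
have := gmulf_Sz_x psi x y i%:Z; rewrite psi_x psi_y Sz_x_lowerg => ->.
by rewrite -PoszM.
Qed.

Lemma psi_squares (b : nat -> bool) :
  psi (\prod_(0 <= i < N) (xconj i ^+ 2) ^+ b i) =
  lowerg hF 0%R (\sum_(0 <= i < N) (b i)%:R * w ^+ (i * (t + 1)))%R.
Proof.
rewrite -(prod_sqr_lowerg hF w_prim) gmulf_prod; apply: eq_bigr => i _.
by rewrite -expgnA gmulfXn -psi_x -psi_y -gmulf_Sz_x.
Qed.

Lemma psi_unip u : unip u -> exists a b, psi u = lowerg hF a b.
Proof.
move=> /(unipP rels)[a [_ [[b ->] ->]]]; rewrite gmulfM psi_squares gmulf_prod.
have [b' E] := prod_lowerg hF w_prim (index_iota 0 N) a.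
under eq_bigr do rewrite gmulfXn -[xconj _]Sz_x_xconj gmulf_Sz_x psi_x psi_y.
by rewrite /= E lowergM; eexists; eexists.
Qed.

(** The first coordinate, by independence of the w^i, kills the exponents of the x_i; then the
    second, by independence of the w^(i(t+1)), kills those of the squares. *)
Lemma psi_unip_eq1 u : unip u -> psi u = 1 -> u = 1.
Proof.
move=> /(unipP rels)[a [_ [[b ->] ->]]]; rewrite gmulfM psi_squares gmulf_prod.
have [b' E] := prod_lowerg hF w_prim (index_iota 0 N) a.
under eq_bigr do rewrite gmulfXn -[xconj _]Sz_x_xconj gmulf_Sz_x psi_x psi_y.
rewrite /= E lowergM -(lowerg0 hF) => /lowerg_inj[]; rewrite addr0 => s0.
have a0 := Sz_bits_free consts s0.
have aE : \prod_(0 <= i < N) xconj i ^+ a i = 1.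
  by rewrite big_nat big1 // => i /andP[_ iN]; rewrite a0.
(* With all bits zero the matrix product is trivial too, which forces its unnamed second coordinate
   [b'] to be 0. *)
have E1 : \prod_(i <- index_iota 0 N)
    Sz_x (lowerg hF 1%R 1%R) (toralg w_prim) i%:Z ^+ a i = 1.
  by rewrite big_nat big1 // => i /andP[_ iN]; rewrite a0.
move: E; rewrite E1 s0 -(lowerg0 hF) => /lowerg_inj[_ <-].
rewrite mulr0 addr0 add0r => b0.
have {}b0 := Sz_bits_free_theta consts b0.
by rewrite aE mul1g big_nat big1 // => i /andP[_ iN]; rewrite b0.
Qed.

Lemma psi_unip_inj u v : unip u -> unip v -> psi u = psi v -> u = v.
Proof.
move=> Uu Uv uv; apply/divg1_eq/psi_unip_eq1.
  exact/unipM/unipV.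
by rewrite gmulfM gmulfV uv mulgV.
Qed.

Lemma psi_borel b : borel b ->
  exists k a a', psi b = toralg w_prim ^+ k * lowerg hF a a'.
Proof.
move=> [k [u [Uu ->]]]; have [a [a' uE]] := psi_unip Uu.
by exists k, a, a'; rewrite gmulfM gmulfXn psi_y uE.
Qed.

(** The diagonal matrix of y^k then equals a unitriangular one. Its first two diagonal entries,
    being 1, have quotient w^k = 1, whence q - 1 divides k and only the unipotent factor is left. *)
Lemma psi_borel_eq1 b : borel b -> psi b = 1 -> b = 1.
Proof.
move=> [k [u [Uu ->]]]; rewrite gmulfM gmulfXn psi_y => yu.
have [a [a' uE]] := psi_unip Uu.
suff yk : y ^+ k = 1.
  move: yu; rewrite -psi_y -gmulfXn yk gmulf1 !mul1g; exact: psi_unip_eq1.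
have /matrixP YE : GLval (toralg w_prim ^+ k) = Sz_lower m a (a' + a ^+ t * a)%R.
  by rewrite -[toralg _ ^+ k]invgK (mulg1_eq yu) uE lowergV.
have w0 := Sz_w_neq0 w_prim.
have := YE (inord 0) (inord 0); have := YE (inord 1) (inord 1).
rewrite toralgX_row !mxE !eqxx !mulr1n !inordK //= => w1.
rewrite exprS exprMn w1 mulr1 => wk.
have : q.-1 %| k by rewrite (prim_order_dvd w_prim) wk.
case/dvdnP => j ->; rewrite mulnC -subn1 expgnA (Sz_rel_yq rels).
exact: expg1n.
Qed.

Lemma psi_z_notin_borel b : borel b -> psi b <> psi z.
Proof.
move=> /psi_borel[k [a [a' ->]]]; rewrite psi_z => /(congr1 GLval).
rewrite GL_MxE toralgX_row mul_diag_mx => /matrixP/(_ (inord 0) (inord 3)).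
rewrite !mxE !inordK //= mulr0 => /esym/eqP; by rewrite oner_eq0.
Qed.

Lemma w_pow_surj (a : F) : (a != 0)%R -> exists i : nat, (a = w ^+ i)%R.
Proof.
move=> a0; have q1 : 1 < q := Sz_q_gt1 m.
have aq : (a ^+ q.-1 = 1)%R.
  by apply: (mulfI a0); rewrite -exprS prednK ?(ltnW q1) // -hF expf_card mulr1.
by have [i ->] := prim_rootP w_prim aq; exists i.
Qed.

(** * The two Bruhat cells *)

Definition big_cell (g : G) : Prop :=
  exists b b', [/\ borel b, borel b' & g = b * z * b'].

Definition cells (g : G) : Prop := borel g \/ big_cell g.

Lemma cellsMl b g : borel b -> cells g -> cells (b * g).
Proof.
move=> Bb [Bg|[b1 [b2 [B1 B2 ->]]]]; first by left; apply: (borelM rels).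
right; exists (b * b1), b2; split=> //; first exact: (borelM rels).
by rewrite !mulgA.
Qed.

Lemma cellsMr b g : borel b -> cells g -> cells (g * b).
Proof.
move=> Bb [Bg|[b1 [b2 [B1 B2 ->]]]]; first by left; apply: (borelM rels).
right; exists b1, (b2 * b); split=> //; first exact: (borelM rels).
by rewrite !mulgA.
Qed.

Lemma cellsV g : cells g -> cells g^-1.
Proof.
move=> [Bg|[b1 [b2 [B1 B2 ->]]]]; first by left; apply: (borelV rels).
right; exists b2^-1, b1^-1; split; try exact: (borelV rels).
by rewrite !invMg (Sz_rel_zV rels) mulgA.
Qed.

(** This is x_(-i)^2; the opposite index arises because z inverts y. *)
Definition xsqr_opp i : G := (x ^+ 2) ^ (y ^- i).

Lemma xsqr_oppJz i :
  xsqr_opp i ^ z = (xconj i)^-1 * y ^- i * y ^- i * z * xconj i.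
Proof.
have zV := Sz_rel_zV rels; have zz : z * z = 1 by rewrite -{1}zV mulVg.
have -> : xsqr_opp i ^ z = (x ^+ 2 ^ z) ^ (y ^+ i).
  rewrite /xsqr_opp conjJg; congr (_ ^ _).
  by rewrite conjVg (yJz rels) invgK.
have zJ : z ^ (y ^+ i) = y ^- i * y ^- i * z.
  have := yJz rels i; rewrite !conjgE zV -!mulgA => E; congr (_ * _).
  by rewrite -[in RHS]E -!mulgA zz mulg1.
rewrite (Sz_rel_x2 rels) 2!conjMg conjVg zJ -[x ^ _]/(xconj i).
by move: (xconj i) => X; rewrite !mulgA.
Qed.

Lemma borel_xconj i : borel (xconj i).
Proof. exact/borel_unip/(unip_xconj_all rels). Qed.

Lemma borelM3 a b g : borel a -> borel b -> borel g -> borel (a * b * g).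
Proof. by move=> Ba Bb Bg; do 2!apply: (borelM rels) => //. Qed.

(** Solving [xsqr_oppJz] for z x_i gives z x_i z = y^(2i) x_i z x_(-i)^2. *)
Lemma cells_xconj i : cells (xconj i ^ z).
Proof.
have := xsqr_oppJz i; rewrite !conjgE (Sz_rel_zV rels) => E.
right; exists (y ^+ i * y ^+ i * xconj i), (xsqr_opp i); split.
- by apply: borelM3; try exact: (borel_y m x y); apply: borel_xconj.
- apply/borel_unip.
  have [k ->] : exists k, xsqr_opp i = xconj k ^+ 2.
    by have [k yk] := y_pow_inv rels i; exists k; rewrite /xsqr_opp yk conjXg.
  exact/(unip_squares rels)/(squares_xconj_all rels).
have zz : z * z = 1 by rewrite -{1}(Sz_rel_zV rels) mulVg.
move: (xsqr_opp i) (xconj i) (y ^+ i) E zz => S X h E zz.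
have zX : z * X = h * h * X * (z * (S * z)) by rewrite E !mulgA !mulgK mulgV mul1g.
by rewrite mulgA zX -!mulgA zz mulg1.
Qed.

Lemma cells_xsqr k : cells ((xconj k ^+ 2) ^ z).
Proof.
have [l yl] := y_pow_inv rels k.
have -> : xconj k ^+ 2 = xsqr_opp l by rewrite /xsqr_opp -yl invgK conjXg.
rewrite xsqr_oppJz; right; exists ((xconj l)^-1 * y ^- l * y ^- l), (xconj l).
split=> //; last exact: borel_xconj.
by apply: borelM3; try exact: (borel_yV rels); apply/(borelV rels)/borel_xconj.
Qed.

(* Since (t - 1)(t + 1) = 1 modulo q - 1,
   every element of F is a (t + 1)-th power. *)
Lemma central_square u b : unip u -> psi u = lowerg hF 0%R b ->
  exists k, u = 1 \/ u = xconj k ^+ 2.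
Proof.
move=> Uu psiu; have [b0|b0] := eqVneq b 0%R.
  by exists 0; left; apply: psi_unip_eq1; rewrite // psiu b0 lowerg0.
(* The square of x_k has second coordinate w^(k(t+1)), so w^k is chosen to be b^(t-1), the (t +
   1)-th root of b. *)
have b1 : (b ^+ t.-1 != 0)%R by rewrite expf_neq0.
have [k kE] := w_pow_surj b1; exists k; right.
apply: psi_unip_inj => //; first exact/(unip_squares rels)/(squares_xconj_all rels).
rewrite psiu gmulfXn /= psi_xconj.
have := lowerg_sqr_torus hF w k; rewrite -PoszM /= => ->; congr lowerg.
rewrite -exprnP exprM -kE -exprM.
apply: (mulfI b0); rewrite -exprS -expr2 -(Sz_thetaK hF) -exprM.
have t0 : 0 < t by rewrite expn_gt0.
by congr (_ ^+ _)%R; move: t0; case: t => // s _; rewrite /= mulnS mulSn; lia.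
Qed.

Lemma cells_xconj_div i j : cells ((xconj i * (xconj j)^-1) ^ z).
Proof.
pose S := xsqr_opp i * xsqr_opp j.
have sq k : squares (xsqr_opp k).
  have [l yl] := y_pow_inv rels k; rewrite /xsqr_opp yl conjXg.
  exact: (squares_xconj_all rels).
have sS : squares S by apply: (squaresM rels).
have US : unip S := unip_squares rels sS.
have cellsS : cells (S ^ z).
  have [b psiS] : exists b, psi S = lowerg hF 0%R b.
    by case: sS => b ->; rewrite psi_squares; eexists.
  have [k [->|->]] := central_square US psiS; last exact: cells_xsqr.
  by rewrite conj1g; left; apply/borel_unip/unip1.
(* The product of the two formulas [xsqr_oppJz], solved for its middle; y^(-2j) crosses z as
   y^(2j). *)
have -> : (xconj i * (xconj j)^-1) ^ z =
    y ^+ i * y ^+ i * xconj i * S ^ z * ((xconj j)^-1 * y ^- j * y ^- j).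
  rewrite [S ^ z]conjMg !xsqr_oppJz.
  have := yJz rels j; rewrite !conjgE (Sz_rel_zV rels).
  have zz : z * z = 1 by rewrite -{1}(Sz_rel_zV rels) mulVg.
  move: (xconj i) (xconj j) (y ^+ i) (y ^+ j) => X X' h h' h'z.
  have {}h'z : h'^-1 * z = z * h' by rewrite -h'z -!mulgA zz mulg1.
  rewrite !mulgA !mulgK mulgV mul1g -!mulgA; congr (_ * (_ * _)).
  rewrite (mulgA h'^-1 z) h'z -!mulgA (mulgA h'^-1 z) h'z -!mulgA.
  by congr (_ * _); rewrite !mulgA !mulgK.
apply: cellsMr; last apply: cellsMl => //.
- by apply: borelM3; try exact: (borel_yV rels); apply/(borelV rels)/borel_xconj.
- by apply: borelM3; try exact: (borel_y m x y); apply: borel_xconj.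
Qed.

Lemma cells_unipJ u : unip u -> cells (u ^ z).
Proof.
move=> Uu; have [a [b uE]] := psi_unip Uu.
have Ux k : unip (xconj k) by apply: (unip_xconj_all rels).
have [a0|a0] := eqVneq a 0%R.
  rewrite a0 in uE; have [k uk] := central_square Uu uE.
  case: uk => ->; last exact: cells_xsqr.
  by rewrite conj1g; left; apply/borel_unip/unip1.
have [h [l [hl bE]]] : exists h l : F, (a = h + l)%R /\ (b = h ^+ t * (h + l))%R.
  (* Since (t/2) t = q, the exponent t/2 inverts raising to the power t, and h^t = b/a. *)
  exists ((b / a) ^+ t./2)%R, (a - (b / a) ^+ t./2)%R.
  rewrite addrC subrK; split=> //; rewrite -exprM.
  have -> : (t./2 * t = q)%N.
    rewrite /Sz_t /Sz_q expnS mul2n doubleK -mul2n -expnS -expnD.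
    by congr (2 ^ _)%N; lia.
  by rewrite -hF expf_card divfK.
have xj j : psi (xconj j) = lowerg hF (w ^+ j)%R ((w ^+ j) ^+ t * w ^+ j)%R.
  by rewrite psi_xconj exprM exprSr.
have xVj j : psi (xconj j)^-1 = lowerg hF (w ^+ j)%R 0%R.
  by rewrite gmulfV /= xj lowergV (addrr_pchar2 (Sz_pchar hF)).
(* Zero is no power of w: when h or l vanishes, u is x_j^-1 or x_i alone. *)
have [h0|/w_pow_surj[i hi]] := eqVneq h 0%R.
  have l0 : l != 0%R by move: a0; rewrite hl h0 add0r.
  have [j lj] := w_pow_surj l0.
  have -> : u = (xconj j)^-1.
    apply: psi_unip_inj => //; first exact/unipV.
    by rewrite xVj uE hl bE h0 expr0n expn_eq0 mul0r add0r lj.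
  by rewrite conjVg; apply/cellsV/cells_xconj.
have [l0|/w_pow_surj[j lj]] := eqVneq l 0%R.
  have -> : u = xconj i.
    by apply: psi_unip_inj => //; rewrite xj uE hl bE l0 addr0 hi.
  exact: cells_xconj.
have -> : u = xconj i * (xconj j)^-1.
  apply: psi_unip_inj => //; first exact/unipM/unipV.
  rewrite gmulfM /= xVj xj lowergM uE hl bE hi lj; congr lowerg.
  by ring.
exact: cells_xconj_div.
Qed.

Lemma cellsMz g : cells g -> cells (g * z).
Proof.
have zz : z * z = 1 by rewrite -{1}(Sz_rel_zV rels) mulVg.
have B1 : borel 1 by apply/borel_unip/unip1.
move=> [Bg|[b [_ [Bb [k [u [Uu ->]]] ->]]]].
  by right; exists g, 1; rewrite mulg1.
have -> : b * z * (y ^+ k * u) * z = b * y ^- k * u ^ z.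
  have := yJz rels k; rewrite !conjgE (Sz_rel_zV rels).
  move: (y ^+ k) => h hz; rewrite -[in RHS]hz !mulgA.
  by rewrite -(mulgA (b * z * h) z z) zz mulg1.
by apply: cellsMl (cells_unipJ Uu); apply: (borelM rels) => //; apply: (borel_yV rels).
Qed.

Lemma cells_psi_eq1 g : cells g -> psi g = 1 -> g = 1.
Proof.
move=> [Bg|[b [b' [Bb Bb' ->]]]]; first exact: psi_borel_eq1.
rewrite !gmulfM /= => E; case: (psi_z_notin_borel (b := b^-1 * b'^-1)).
  by apply: (borelM rels); apply: (borelV rels).
rewrite gmulfM !gmulfV /=; apply: (mulgI (psi b)); apply: (mulIg (psi b')).
by rewrite mulVKg mulVg -E.
Qed.

End SzKernel.

(** * The isomorphism with the matrix group *)

Lemma Sz_gens (F : finFieldType) (m : nat) (hF : #|F| = Sz_q m) (w : F)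
    (w_prim : ((Sz_q m).-1.-primitive_root w)%R) (g : {'GL_4[F]}) :
  (GLval g \in [:: Sz_xhat F; Sz_yhat m w; Sz_zhat F]) =
  (g \in [:: lowerg hF 1%R 1%R; toralg w_prim; weylg F]).
Proof.
rewrite !inE -!(inj_eq val_inj) /= (Sz_xhatE hF).
by [].
Qed.

Lemma Sz_presentation_iso (m : nat) (F : finFieldType) (hF : #|F| = Sz_q m) (w : F)
    (c d e : nat -> bool) :
  ((Sz_q m).-1.-primitive_root w)%R ->
  Sz_constants hF w c d e ->
  group_isomorphic [subg (Sz m w)]%type (Sz_presentation m c d e).
Proof.
move=> w_prim consts.
pose X := lowerg hF 1%R 1%R; pose Y := toralg w_prim; pose Z := weylg F.
pose f (i : 'I_3) : {'GL_4[F]} := nth 1 [:: X; Y; Z] i.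
set R := Sz_relations m c d e (free_gen (inord 0 : 'I_3)) (free_gen (inord 1))
  (free_gen (inord 2)).
have gE i : i < 3 -> free_val f (free_gen (inord i)) = nth 1 [:: X; Y; Z] i.
  by move=> i3; rewrite free_val_gen /f inordK.
have fR : {in R, forall r, free_val f r.1 = free_val f r.2}.
  have := Sz_relations_lowerg w_prim consts.
  have -> : Sz_relations m c d e X Y Z =
      [seq (free_val f r.1, free_val f r.2) | r <- R].
    rewrite -(Sz_relations_morph m c d e (free_val f : UMagmaMorphism.type _ _)).
    by rewrite /= !gE.
  by rewrite /relations_hold all_map => /allP h r /h /eqP.
pose psi : presented_group R -> {'GL_4[F]} := pres_val f.
have psiM : {morph psi : a b / a * b} := pres_valM fR.
have psi1 : psi 1 = 1 := (morphM_monoid_morphism psiM).1.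
pose psim : UMagmaMorphism.type (presented_group R) {'GL_4[F]} :=
  HB.pack psi (isUMagmaMorphism.Build _ _ psi (morphM_monoid_morphism psiM)).
pose p i : presented_group R := pres_of_free R (free_gen (inord i)).
have psi_p i : i < 3 -> psi (p i) = nth 1 [:: X; Y; Z] i.
  by move=> i3; rewrite [psi _](pres_val_gen fR) /f inordK.
have pR : relations_hold (Sz_relations m c d e (p 0%N) (p 1%N) (p 2%N)).
  rewrite (Sz_relations_morph m c d e (@pres_of_free 3 R : UMagmaMorphism.type _ _)).
  by rewrite /relations_hold all_map; apply/allP=> r /pres_of_free_rel/= ->.
have psi_x : psim (p 0%N) = X := psi_p 0%N isT.
have psi_y : psim (p 1%N) = Y := psi_p 1%N isT.
have psi_z : psim (p 2%N) = Z := psi_p 2%N isT.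
have gens i : exists2 k, k < 3 & pres_of_free R (free_gen i) = p k.
  by exists i => //; rewrite /p inord_val.
have pcase (A : presented_group R -> Prop) : A (p 0%N) -> A (p 1%N) -> A (p 2%N) ->
    forall i, A (pres_of_free R (free_gen i)).
  by move=> A0 A1 A2 i; have [[|[|[|k]]] // _ ->] := gens i.
have Bp0 : borel m (p 0%N) (p 1%N) (p 0%N).
  by have := borel_xconj pR 0; rewrite [xconj _ _ _]conjg1.
have Bp1 : borel m (p 0%N) (p 1%N) (p 1%N) := borel_y m (p 0%N) (p 1%N) 1.
have cells_all g : cells m (p 0%N) (p 1%N) (p 2%N) g.
  elim/pres_gen_ind: g => [|i g gC|i g gC]; first exact/or_introl/borel_unip/unip1.
    apply: (pcase (fun h => cells m (p 0%N) (p 1%N) (p 2%N) (g * h))).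
    - exact: (cellsMr pR).
    - exact: (cellsMr pR).
    - exact: (cellsMz consts pR psi_x psi_y).
  apply: (pcase (fun h => cells m (p 0%N) (p 1%N) (p 2%N) (g * h^-1))).
  - exact/(cellsMr pR)/gC/(borelV pR).
  - exact/(cellsMr pR)/gC/(borelV pR).
  - by rewrite (Sz_rel_zV pR); apply: (cellsMz consts pR psi_x psi_y).
have psi_inj : injective psi.
  apply: (gmulf_inj (f := psim)) => g.
  exact: (cells_psi_eq1 consts pR psi_x psi_y psi_z (cells_all g)).
have psi_Sz g : psi g \in Sz m w.
  have Szp i : psi (pres_of_free R (free_gen i)) \in Sz m w.
    apply: (pcase (fun h => psi h \in Sz m w)); apply: mem_gen;
      by rewrite inE (Sz_gens hF w_prim) psi_p // !inE eqxx ?orbT.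
  elim/pres_gen_ind: g => [|i g gS|i g gS].
  - by rewrite psi1 group1.
  - by rewrite psiM groupM.
  - by rewrite psiM -[psi _^-1]/(psim _^-1) gmulfV groupM ?groupV.
have psi_surj (s : {'GL_4[F]}) : s \in Sz m w -> exists g, psi g = s.
  (* The image, taken as a subset of the finite group GL(4, q), is a subgroup containing the three
     generators. *)
  pose im := [set s | `[< exists g, psi g = s >]].
  have im_group : group_set im.
    apply/group_setP; split=> [|s1 s2].
      by rewrite inE; apply/asboolP; exists 1.
    rewrite !inE => /asboolP[g <-] /asboolP[h <-]; apply/asboolP.
    by exists (g * h); apply: psiM.
  have /subsetP sub : Sz m w \subset group im_group.
    rewrite gen_subG; apply/subsetP => g; rewrite inE (Sz_gens hF w_prim) !inE.
    case/or3P=> /eqP ->; apply/asboolP.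
    - by exists (p 0%N).
    - by exists (p 1%N).
    - by exists (p 2%N).
  by move=> /sub; rewrite inE => /asboolP.
(* The required map starts from the matrices, so preimages under [psi] are chosen; injectivity of
   [psi] makes the choice multiplicative. *)
have pre (s : [subg (Sz m w)]%type) : exists g, psi g == val s.
  by have [g <-] := psi_surj _ (valP s); exists g.
pose g (s : [subg (Sz m w)]%type) : presented_group R := xchoose (pre s).
have gK s : psi (g s) = val s by apply/eqP/(xchooseP (pre s)).
exists g.
  by move=> s1 s2; apply: psi_inj; rewrite psiM !gK.
exists (fun a => subg (Sz m w) (psi a)) => [s|a].
  by apply: val_inj; rewrite /= subgK ?psi_Sz // gK.
by apply: psi_inj; rewrite gK [val _]subgK ?psi_Sz.
Qed.

(** * Straight-line black box programs *)

(* In a register word, [(i, true)] stands for the inverse of register [i]. *)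
Definition regword := seq (nat * bool).

(** [IBit] also advances its tape, so that one pass of straight-line code consumes one bit of each
    constant. Tape numbers are shifted by one on the machine, whose tape 0 carries the answer. *)
Inductive instr :=
| ISet of nat & regword
| ICheck of regword
| IBit of nat & nat & regword
| IMoveLeft of nat
| IMoveRight of nat.

(* Machine registers 3, 4 and 5 hold the identity, the partial product and an
   inverse; the other ones are numbered consecutively. *)
Definition preg (i : nat) : nat := if i < 3 then i else (i + 3)%N.

Fixpoint mul_regword (l : regword) : program :=
  if l is p :: l' then
    Seq (if p.2 then Seq (Inv 5 (preg p.1)) (Mul 4 4 5) else Mul 4 4 (preg p.1))
        (mul_regword l')
  else Skip.

Definition eval_regword (l : regword) : program := Seq (Mul 4 3 3) (mul_regword l).

(** The last multiplication, by the identity in register 3, is a copy. As the product is accumulated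
    elsewhere, [l] may mention [r] itself. *)
Definition set_regword (r : nat) (l : regword) : program :=
  Seq (eval_regword l) (Mul (preg r) 4 3).

Definition compile_instr (i : instr) : program :=
  match i with
  | ISet r l => set_regword r l
  | ICheck l => Seq (eval_regword l) (If (TestOne 4) Skip (Write 0 (Some false)))
  | IBit k r l =>
      Seq (If (TestSymbol k.+1 (Some true)) (set_regword r l) Skip) (MoveRight k.+1)
  | IMoveLeft k => MoveLeft k.+1
  | IMoveRight k => MoveRight k.+1
  end.

Definition compile (s : seq instr) : program :=
  foldr (fun i P => Seq (compile_instr i) P) Skip s.

(** Costs count oracle times: at most two calls per letter, one to initialise the product and one
    for the final [Skip]. *)
Definition regword_cost (l : regword) : nat := 2 + 2 * size l.
Definition instr_cost (i : instr) : nat :=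
  match i with
  | ISet _ l => (regword_cost l).+1
  | ICheck l => regword_cost l + 2
  | IBit _ _ l => regword_cost l + 3
  | IMoveLeft _ | IMoveRight _ => 1
  end.
Definition code_cost (s : seq instr) : nat := (sumn (map instr_cost s)).+1.

(** * An abstract machine over group elements and its simulation *)

Definition blank_tape : tape := tape_of_bits [::].

Section AbstractMachine.
Variables (gT : finGroupType) (B : black_box gT).
Local Notation mu := (bb_time B).

Definition regval (regs : seq gT) (p : nat * bool) : gT :=
  if p.2 then (nth 1 regs p.1)^-1 else nth 1 regs p.1.
Fixpoint wordval (regs : seq gT) (l : regword) : gT :=
  if l is p :: l' then regval regs p * wordval regs l' else 1.
Definition word_ok (regs : seq gT) (l : regword) : bool :=
  all (fun p => p.1 < size regs) l.

Record mstate := MState { ms_flag : bool; ms_regs : seq gT; ms_tapes : seq tape }.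

Definition step_instr (i : instr) (a : mstate) : option mstate :=
  let: MState fl regs tapes := a in
  match i with
  | ISet r l =>
      if word_ok regs l && (r <= size regs)
      then Some (MState fl (set_nth 1 regs r (wordval regs l)) tapes) else None
  | ICheck l =>
      if word_ok regs l then Some (MState (fl && (wordval regs l == 1)) regs tapes)
      else None
  | IBit k r l =>
      if word_ok regs l && (r < size regs) then
        let T := nth blank_tape tapes k in
        Some (MState fl
          (set_nth 1 regs r
            (if tape_head T == Some true then wordval regs l else nth 1 regs r))
          (set_nth blank_tape tapes k (tape_move_right T)))
      else None
  | IMoveLeft k => Some (MState fl regs
      (set_nth blank_tape tapes k (tape_move_left (nth blank_tape tapes k))))
  | IMoveRight k => Some (MState fl regs
      (set_nth blank_tape tapes k (tape_move_right (nth blank_tape tapes k))))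
  end.

Definition step_code (s : seq instr) (a : mstate) : option mstate :=
  foldl (fun oa i => obind (step_instr i) oa) (Some a) s.

Definition holds_reg (st : state B) (r : nat) (g : gT) : Prop :=
  exists2 s, st_reg st r = Some s & bb_decode s = Some g.

Record models (st : state B) (a : mstate) : Prop := Models {
  models_flag : st_tape st 0 = Tape [::] (Some (ms_flag a)) [::];
  models_tapes : forall k, st_tape st k.+1 = nth blank_tape (ms_tapes a) k;
  models_one : holds_reg st 3 1;
  models_regs : forall i, i < size (ms_regs a) ->
    holds_reg st (preg i) (nth 1 (ms_regs a) i)
}.

Lemma preg_neq i :
  (preg i == 3 = false) * (preg i == 4 = false) * (preg i == 5 = false).
Proof. by rewrite /preg; case: (ltnP i 3) => i3; do !split; apply/eqP; lia. Qed.

Lemma preg_inj : injective preg.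
Proof.
by move=> i j; rewrite /preg; case: (ltnP i 3) => i3; case: (ltnP j 3) => j3; lia.
Qed.

(** A Hoare triple for total correctness with a time bound in multiples of [mu]. *)
Definition runs (P : program) (k : nat) (st : state B) (Q : state B -> Prop) : Prop :=
  exists st' n, [/\ exec P st st' n, n <= k * mu & Q st'].

Lemma runs_seq P1 P2 k1 k2 st Q1 Q : runs P1 k1 st Q1 ->
  (forall st', Q1 st' -> runs P2 k2 st' Q) -> runs (Seq P1 P2) (k1 + k2) st Q.
Proof.
move=> [st1 [n1 [e1 n1k q1]]] /(_ st1 q1) [st2 [n2 [e2 n2k q2]]].
exists st2, (n1 + n2)%N; split=> //; first exact: exec_seq e1 e2.
by rewrite mulnDl leq_add.
Qed.

Lemma runs_weaken P k k' st (Q Q' : state B -> Prop) : k <= k' ->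
  (forall st', Q st' -> Q' st') -> runs P k st Q -> runs P k' st Q'.
Proof.
move=> kk' QQ' [st' [n [e nk q]]]; exists st', n; split=> //; last exact: QQ'.
by rewrite (leq_trans nk) // leq_mul2r kk' orbT.
Qed.

Lemma runs_skip st (Q : state B -> Prop) : Q st -> runs Skip 1 st Q.
Proof.
by move=> q; exists st, 1%N; rewrite mul1n bb_time_gt0; split=> //; constructor.
Qed.

Lemma runs_Mul (st : state B) r r1 r2 g1 g2 :
  holds_reg st r1 g1 -> holds_reg st r2 g2 ->
  runs (Mul r r1 r2) 1 st (fun st' => [/\ st_tape st' = st_tape st,
    holds_reg st' r (g1 * g2) & forall j, j != r -> st_reg st' j = st_reg st j]).
Proof.
move=> [s1 e1 d1] [s2 e2 d2].
exists (set_reg r (bb_mul s1 s2) st), mu; rewrite mul1n.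
split=> //; first exact: exec_mul.
split=> // [|j /negbTE jr]; last by rewrite /= jr.
by exists (bb_mul s1 s2); rewrite /= ?eqxx //; apply: bb_mulP.
Qed.

Lemma runs_Inv (st : state B) r r1 g1 : holds_reg st r1 g1 ->
  runs (Inv r r1) 1 st (fun st' => [/\ st_tape st' = st_tape st,
    holds_reg st' r g1^-1 & forall j, j != r -> st_reg st' j = st_reg st j]).
Proof.
move=> [s1 e1 d1].
exists (set_reg r (bb_inv s1) st), mu; rewrite mul1n.
split=> //; first exact: exec_inv.
split=> // [|j /negbTE jr]; last by rewrite /= jr.
by exists (bb_inv s1); rewrite /= ?eqxx //; apply: bb_invP.
Qed.

Lemma runs_if b v P1 P2 k st Q : eval_test b st = Some v ->
  runs (if v then P1 else P2) k st Q -> runs (If b P1 P2) k.+1 st Q.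
Proof.
move=> bv [st' [n [e nk q]]]; exists st', (test_time B b + n)%N; split=> //.
  by case: v bv e => bv e; [apply: exec_if_true | apply: exec_if_false].
by rewrite mulSn leq_add //; case: (b); rewrite /= ?bb_time_gt0.
Qed.

Lemma runs_while_false b P st (Q : state B -> Prop) : eval_test b st = Some false ->
  Q st -> runs (While b P) 1 st Q.
Proof.
move=> bf q; exists st, (test_time B b); split=> //; first exact: exec_while_false.
by rewrite mul1n; case: (b); rewrite /= ?bb_time_gt0.
Qed.

Lemma runs_while_true b P k1 k2 st Q1 Q : eval_test b st = Some true ->
  runs P k1 st Q1 -> (forall st', Q1 st' -> runs (While b P) k2 st' Q) ->
  runs (While b P) (k1 + k2).+1 st Q.
Proof.
move=> bt [st1 [n1 [e1 n1k q1]]] /(_ st1 q1) [st2 [n2 [e2 n2k q2]]].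
exists st2, (test_time B b + n1 + n2)%N; split=> //; first exact: exec_while_true e1 e2.
rewrite -addnA mulSn leq_add //; first by case: (b); rewrite /= ?bb_time_gt0.
by rewrite mulnDl leq_add.
Qed.

Definition frame (st st' : state B) : Prop :=
  st_tape st' = st_tape st /\
  forall j, j != 4 -> j != 5 -> st_reg st' j = st_reg st j.

Lemma frame_trans st1 st2 st3 : frame st1 st2 -> frame st2 st3 -> frame st1 st3.
Proof.
move=> [t12 r12] [t23 r23]; split; first by rewrite t23.
by move=> j j4 j5; rewrite r23 ?r12.
Qed.

Lemma models_frame st st' a : frame st st' -> models st a -> models st' a.
Proof.
move=> [tE rE] [fl tapes one regs]; split; rewrite ?tE //.
  by have [s e1 e2] := one; exists s; rewrite ?rE.
move=> i /regs[s e1 e2]; exists s => //.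
by rewrite rE ?preg_neq.
Qed.

Lemma runs_mul_regword (a : mstate) (l : regword) (st : state B) g :
  models st a -> word_ok (ms_regs a) l -> holds_reg st 4 g ->
  runs (mul_regword l) (2 * size l).+1 st (fun st' =>
    frame st st' /\ holds_reg st' 4 (g * wordval (ms_regs a) l)).
Proof.
elim: l st g => [|p l IHl] st g Ma /=.
  by move=> _ Hg; apply: runs_skip; rewrite mulg1.
case/andP=> p_ok l_ok Hg; rewrite mulnS -addnS.
have Hp := models_regs Ma p_ok.
pose g' := g * regval (ms_regs a) p.
apply: (@runs_seq _ _ _ _ _ (fun st' => frame st st' /\ holds_reg st' 4 g')).
  rewrite /g' /regval; case: p.2.
    apply: (runs_seq (k1 := 1) (k2 := 1)); first exact: runs_Inv Hp.
    move=> st1 [t1 h1 r1].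
    have Hg1 : holds_reg st1 4 g by have [s es ds] := Hg; exists s; rewrite // r1.
    apply: runs_weaken (runs_Mul 4 Hg1 h1) => // st2 [t2 h2 r2].
    by split=> //; split=> [|j j4 j5]; rewrite ?t2 // r2 // r1.
  apply: runs_weaken (runs_Mul 4 Hg Hp) => // st2 [t2 h2 r2].
  by split=> //; split=> // j j4 _; apply: r2.
move=> st1 [f1 h1]; apply: runs_weaken (IHl _ _ (models_frame f1 Ma) l_ok h1) => //.
by move=> st2 [f2 h2]; rewrite mulgA; split=> //; apply: frame_trans f1 f2.
Qed.

Lemma runs_eval_regword (a : mstate) (l : regword) (st : state B) :
  models st a -> word_ok (ms_regs a) l ->
  runs (eval_regword l) (regword_cost l) st (fun st' =>
    frame st st' /\ holds_reg st' 4 (wordval (ms_regs a) l)).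
Proof.
move=> Ma l_ok; rewrite /regword_cost -[(2 + _)%N]/(1 + (2 * size l).+1)%N.
have H1 := models_one Ma.
apply: runs_seq (runs_Mul 4 H1 H1) _ => st1 [t1 h1 r1].
have f1 : frame st st1 by split=> // j j4 _; apply: r1.
apply: runs_weaken (runs_mul_regword (models_frame f1 Ma) l_ok h1) => //.
by move=> st2 [f2 h2]; rewrite !mul1g in h2; split=> //; apply: frame_trans f1 f2.
Qed.

Lemma runs_set_regword (a : mstate) r (l : regword) (st : state B) :
  models st a -> word_ok (ms_regs a) l -> r <= size (ms_regs a) ->
  runs (set_regword r l) (regword_cost l).+1 st (fun st' =>
    models st' (MState (ms_flag a) (set_nth 1 (ms_regs a) r (wordval (ms_regs a) l))
                  (ms_tapes a))).
Proof.
move=> Ma l_ok rs; rewrite -addn1.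
apply: runs_seq (runs_eval_regword Ma l_ok) _ => st1 [f1 h1].
have M1 := models_frame f1 Ma.
apply: runs_weaken (runs_Mul (preg r) h1 (models_one M1)) => // st2 [t2 h2 r2].
rewrite mulg1 in h2; split; rewrite ?t2 /=.
- exact: models_flag M1.
- exact: models_tapes M1.
- by have [s es ds] := models_one M1; exists s; rewrite // r2 // eq_sym preg_neq.
move=> i; rewrite size_set_nth nth_set_nth /=.
have [->|ir] := eqVneq i r; first by [].
rewrite leq_max ltnS => ilt.
have ilt' : i < size (ms_regs a) by lia.
have [s es ds] := models_regs M1 ilt'; exists s; rewrite // r2 //.
by apply: contra ir => /eqP/preg_inj/eqP.
Qed.

Lemma runs_tape st a k (f : tape -> tape) P :
  models st a -> exec P st (set_tape k.+1 f st) 1 ->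
  runs P 1 st (fun st' => models st' (MState (ms_flag a) (ms_regs a)
    (set_nth blank_tape (ms_tapes a) k (f (nth blank_tape (ms_tapes a) k))))).
Proof.
move=> Ma e; exists (set_tape k.+1 f st), 1%N; rewrite mul1n bb_time_gt0.
split=> //; split=> /=.
- exact: models_flag Ma.
- move=> j; rewrite eqSS nth_set_nth /=.
  by have [->|_] := eqVneq j k; rewrite (models_tapes Ma).
- exact: models_one Ma.
- exact: models_regs Ma.
Qed.

Lemma runs_instr i a a' st : step_instr i a = Some a' -> models st a ->
  runs (compile_instr i) (instr_cost i) st (fun st' => models st' a').
Proof.
case: a => fl regs tapes; case: i => [r l|l|k r l|k|k] /=.
- by case: ifP => // /andP[l_ok rs] [<-] Ma; apply: runs_set_regword Ma l_ok rs.
- case: ifP => // l_ok [<-] Ma.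
  apply: runs_seq (runs_eval_regword Ma l_ok) _ => st1 [f1 h1].
  have M1 := models_frame f1 Ma; have [s es ds] := h1.
  apply: (@runs_if _ (wordval regs l == 1)); first by rewrite /= es /= (bb_is1P ds).
  case: eqP => _; rewrite ?andbT ?andbF; first exact: runs_skip.
  exists (set_tape 0 (tape_write (Some false)) st1), 1%N; rewrite mul1n bb_time_gt0.
  split=> //; first exact: exec_write.
  split=> /=.
  + by rewrite (models_flag M1).
  + exact: models_tapes M1.
  + exact: models_one M1.
  + exact: models_regs M1.
- case: ifP => // /andP[l_ok rs] [<-] Ma; rewrite -(addn1 2) addnA addn2.
  set T := nth blank_tape tapes k.
  pose regs' := set_nth 1 regs r
    (if tape_head T == Some true then wordval regs l else nth 1 regs r).
  apply: (@runs_seq _ _ _ _ _ (fun st' => models st' (MState fl regs' tapes))).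
    apply: (@runs_if _ (tape_head T == Some true)).
      by rewrite /= (models_tapes Ma).
    rewrite /regs'; case: eqP => _; first exact: runs_set_regword Ma l_ok (ltnW rs).
    (* For a bit other than 1 the abstract step rewrites the old value, which changes nothing
       because [r] is already in range. *)
    have -> : set_nth 1 regs r (nth 1 regs r) = regs.
      apply: (@eq_from_nth _ 1) => [|i _]; first by rewrite size_set_nth (maxn_idPr rs).
      by rewrite nth_set_nth /=; case: eqP => [->|].
    exact: (runs_weaken _ (fun st' M => M) (runs_skip Ma)).
  by move=> st1 M1; apply: runs_tape M1 _; apply: exec_right.
- by move=> [<-] Ma; apply: runs_tape Ma _; apply: exec_left.
- by move=> [<-] Ma; apply: runs_tape Ma _; apply: exec_right.
Qed.

Lemma step_code_cons i s a :
  step_code (i :: s) a = obind (step_code s) (step_instr i a).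
Proof. by rewrite /step_code /=; case: step_instr => //; elim: s. Qed.

Lemma runs_code s a a' st : step_code s a = Some a' -> models st a ->
  runs (compile s) (code_cost s) st (fun st' => models st' a').
Proof.
elim: s a st => [|i s IHs] a st.
  by move=> [<-] Ma; apply: runs_skip.
rewrite step_code_cons; case E: (step_instr i a) => [a1|] //= sE Ma.
 rewrite /code_cost /= -addnS.
by apply: runs_seq (runs_instr E Ma) _ => st1; apply: IHs.
Qed.

End AbstractMachine.

Arguments step_code : simpl never.

(** * Checking the relations in linear time *)

(** No string for the identity is supplied; it is computed as x x^-1. *)
Definition init_program : program :=
  Seq (Write 0 (Some true)) (Seq (Inv 4 0) (Mul 3 0 4)).

(* Registers: 0-2 hold x, y, z; 3 and 4 hold y^(2^i) and y^(4^i); 5 and 6 hold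
   y^(t-1) and y^(2-t); 7, 8 and 9 hold x_i, x_(i(t-1)) and x_(i(2-t)); 10, 11
   and 12 hold the partial products of the relations in R_2. *)
Definition code_start : seq instr :=
  [:: ISet 3 [:: (1, false)]; ISet 4 [:: (1, false)];
      ICheck (nseq 4 (0, false)); ICheck (nseq 2 (2, false));
      ICheck [:: (1, false); (2, false); (1, false); (2, false)];
      ICheck [:: (0, false); (2, false); (0, false); (0, false);
                 (2, false); (0, true); (2, false)]]%N.

Definition code_square : seq instr :=
  [:: ISet 3 (nseq 2 (3, false)); ISet 4 (nseq 4 (4, false)); IMoveRight 0]%N.

(** After m rounds of [code_square] one more squaring gives y^t and y^q. The bit e_0 is read here
    because [e] starts at index 0 while [c] and [d] start at 1, and the head of the unary tape steps
    back onto its last mark. *)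
Definition code_middle : seq instr :=
  [:: ISet 3 (nseq 2 (3, false)); ISet 4 (nseq 2 (4, false));
      ICheck [:: (4, false); (1, true)];
      ISet 5 [:: (3, false); (1, true)];
      ISet 6 [:: (1, false); (1, false); (3, true)];
      ISet 7 [:: (0, false)]; ISet 8 [:: (0, false)]; ISet 9 [:: (0, false)];
      ISet 10 (nseq 2 (0, false)); ISet 11 [:: (0, false)]; ISet 12 [::];
      IBit 3 12 (nseq 2 (0, false)); IMoveLeft 0]%N.

Definition code_relations : seq instr :=
  [:: ISet 7 [:: (1, true); (7, false); (1, false)];
      ISet 8 [:: (5, true); (8, false); (5, false)];
      ISet 9 [:: (6, true); (9, false); (6, false)];
      ICheck [:: (0, true); (0, true); (7, true); (0, false); (0, false); (7, false)];
      ICheck [:: (0, true); (7, true); (0, false); (7, false);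
                 (9, true); (9, true); (8, true); (8, true)];
      IBit 1 10 [:: (7, false); (7, false); (10, false)];
      IBit 2 11 [:: (7, false); (11, false)];
      IBit 3 12 [:: (7, false); (7, false); (12, false)]]%N.

Definition code_end : seq instr :=
  [:: ISet 7 [:: (1, true); (7, false); (1, false)];
      ICheck [:: (7, false); (7, false); (10, false)];
      ICheck [:: (7, false); (11, false); (12, true)]]%N.

(** The first loop runs through the m unary marks forwards and the second backwards; the second
    treats two indices per mark, as there are 2m of them. *)
Definition Sz_program : program :=
  Seq init_program
 (Seq (compile code_start)
 (Seq (While (TestSymbol 1%N (Some true)) (compile code_square))
 (Seq (compile code_middle)
 (Seq (While (TestSymbol 1%N (Some true))
        (Seq (compile code_relations) (Seq (compile code_relations)
          (compile [:: IMoveLeft 0]))))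
      (compile code_end))))).

Definition tape_cursor (l : seq (option bool)) (s : seq (option bool)) : tape :=
  Tape l (head None s) (behead s).

Section Correctness.
Variables (m : nat) (c d e : nat -> bool) (gT : finGroupType) (B : black_box gT).
Variables x y z : gT.
Local Notation N := (2 * m).+1.
Local Notation t := (Sz_t m).
Local Notation q := (Sz_q m).

Definition ypow1 := y ^+ t * y^-1.
Definition ypow2 := y * y * y^- t.

Lemma expgz_sub (a b : nat) : expgz y (a%:Z - b%:Z)%R = y ^+ a * y ^- b.
Proof.
have [ab|/ltnW ba] := leqP b a; first by rewrite subzn //= expgnFr.
rewrite -opprB subzn //.
have -> : y ^+ a * y ^- b = y ^- (b - a).
  by apply: invg_inj; rewrite invgF invgK expgnFr.
by case: (b - a)%N => [|n] /=; rewrite ?invg1.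
Qed.

Lemma Sz_x_ypow1 i : Sz_x x y (i%:Z * (t%:Z - 1))%R = x ^ (ypow1 ^+ i).
Proof.
rewrite /Sz_x mulrBr mulr1 -PoszM expgz_sub /ypow1; congr (_ ^ _).
rewrite expgMn; last exact/commuteV/commute_sym/commuteX/commute_refl.
by rewrite -expgnA expVgn mulnC.
Qed.

Lemma Sz_x_ypow2 i : Sz_x x y (i%:Z * (2%:Z - t%:Z))%R = x ^ (ypow2 ^+ i).
Proof.
rewrite /Sz_x mulrBr -!PoszM expgz_sub /ypow2 -expg2; congr (_ ^ _).
rewrite expgMn; last exact/commuteV/commuteX2/commute_refl.
by rewrite -!expgnA expVgn -expgnA !(mulnC i).
Qed.

Let xc (i : nat) := x ^ (y ^+ i).

Definition accC i := \prod_(j <- rev (index_iota 1 i.+1)) xc j ^+ (2 * c j) * x ^+ 2.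
Definition accD i := \prod_(j <- rev (index_iota 1 i.+1)) xc j ^+ d j * x.
Definition accE i := \prod_(j <- rev (index_iota 0 i.+1)) xc j ^+ (2 * e j).

(** The products in R_2 list the highest index first, so the accumulators grow by multiplication on
    the left. *)
Lemma rev_iota_recr k i : k <= i.+1 ->
  rev (index_iota k i.+2) = i.+1 :: rev (index_iota k i.+1).
Proof.
move=> ki; rewrite /index_iota subSn // -[(_ - _).+1]addn1 iotaD rev_cat /=.
by rewrite subnKC.
Qed.

Lemma accCS i : accC i.+1 = xc i.+1 ^+ (2 * c i.+1) * accC i.
Proof. by rewrite /accC rev_iota_recr // big_cons; apply/esym/mulgA. Qed.

Lemma accDS i : accD i.+1 = xc i.+1 ^+ d i.+1 * accD i.
Proof. by rewrite /accD rev_iota_recr // big_cons; apply/esym/mulgA. Qed.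

Lemma accES i : accE i.+1 = xc i.+1 ^+ (2 * e i.+1) * accE i.
Proof. by rewrite /accE rev_iota_recr // big_cons. Qed.

Definition data_tape (f : nat -> bool) (l : seq (option bool)) (i : nat) : tape :=
  tape_cursor l [seq Some (f j) | j <- iota i.+1 (2 * m - i)].

(** The invariant of the second loop once the indices up to i are treated. *)
Definition relations_state (fl : bool) (A Q : gT) (T : tape)
    (lc ld le : seq (option bool)) (i : nat) : mstate gT :=
  MState fl [:: x; y; z; A; Q; ypow1; ypow2; xc i; x ^ (ypow1 ^+ i); x ^ (ypow2 ^+ i);
                accC i; accD i; accE i]
         [:: T; data_tape c lc i; data_tape d ld i; data_tape e le i].


Lemma data_tape_right f l i : i < 2 * m ->
  tape_move_right (data_tape f l i) = data_tape f (Some (f i.+1) :: l) i.+1.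
Proof.
by move=> im; rewrite /data_tape -(subnSK im).
Qed.

Lemma data_tape_head f l i : i < 2 * m ->
  (tape_head (data_tape f l i) == Some true) = f i.+1.
Proof. by move=> im; rewrite /data_tape -(subnSK im) /=; case: (f _). Qed.

Lemma conj_word (a g : gT) : g^-1 * (a * (g * 1)) = a ^ g.
Proof. by rewrite mulg1. Qed.

Lemma commg_sqr_word (a b : gT) :
  a^-1 * (a^-1 * (b^-1 * (a * (a * (b * 1))))) = [~ a ^+ 2, b].
Proof. by rewrite mulg1 /commg /conjg expg2 invMg !mulgA. Qed.

Lemma commg_word (a b u v : gT) :
  a^-1 * (b^-1 * (a * (b * (v^-1 * (v^-1 * (u^-1 * (u^-1 * 1))))))) =
  [~ a, b] * (u ^+ 2 * v ^+ 2)^-1.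
Proof. by rewrite mulg1 /commg /conjg !expg2 !invMg !mulgA. Qed.

Lemma bit_sqr_word (b : bool) (a g : gT) :
  (if b then a * (a * (g * 1)) else g) = a ^+ (2 * b) * g.
Proof. by case: b; rewrite ?mulg1 ?mul1g // expg2 mulgA. Qed.

Lemma bit_word (b : bool) (a g : gT) : (if b then a * (g * 1) else g) = a ^+ b * g.
Proof. by case: b; rewrite ?mulg1 ?mul1g. Qed.

Lemma step_relations_word fl (A Q g h u v w a1 a2 a3 : gT) T tc td te :
  let bit (T' : tape) := tape_head T' == Some true in
  step_code code_relations (MState fl [:: x; y; z; A; Q; g; h; u; v; w; a1; a2; a3]
    [:: T; tc; td; te]) =
  Some (MState (fl && ([~ x ^+ 2, u ^ y] == 1) &&
      ([~ x, u ^ y] * ((v ^ g) ^+ 2 * (w ^ h) ^+ 2)^-1 == 1))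
    [:: x; y; z; A; Q; g; h; u ^ y; v ^ g; w ^ h; (u ^ y) ^+ (2 * bit tc) * a1;
        (u ^ y) ^+ bit td * a2; (u ^ y) ^+ (2 * bit te) * a3]
    [:: T; tape_move_right tc; tape_move_right td; tape_move_right te]).
Proof.
do ![rewrite step_code_cons /regval /=]; rewrite /step_code /= !conj_word.
move: (u ^ y) (v ^ g) (w ^ h) => u' v' w'.
by rewrite commg_sqr_word commg_word !bit_sqr_word bit_word.
Qed.

Lemma step_relations fl A Q T lc ld le i : i < 2 * m ->
  step_code code_relations (relations_state fl A Q T lc ld le i) =
  Some (relations_state (fl && relations_hold (Sz_R1_at m x y i.+1)) A Q T
     (Some (c i.+1) :: lc) (Some (d i.+1) :: ld) (Some (e i.+1) :: le) i.+1).
Proof.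
move=> im.
have xS g k : (x ^ (g ^+ k)) ^ g = x ^ (g ^+ k.+1) by rewrite expgSr conjgM.
rewrite /relations_state step_relations_word !data_tape_right // !data_tape_head //.
rewrite !xS accCS accDS accES -andbA.
rewrite /relations_hold /Sz_R1_at /= andbT Sz_x_ypow1 Sz_x_ypow2.
by rewrite [Sz_x x y 0]conjg1.
Qed.

Lemma step_start T (tapes : seq tape) :
  step_code code_start (MState true [:: x; y; z] (T :: tapes)) =
  Some (MState [&& x ^+ 4 == 1, z ^+ 2 == 1, (y * z) ^+ 2 == 1 &
                x * z * x ^+ 2 * z * x^-1 * z == 1] [:: x; y; z; y; y] (T :: tapes)).
Proof.
do ![rewrite step_code_cons /regval /=]; rewrite !mulg1; congr (Some (MState _ _ _)).
rewrite -!andbA; congr [&& _, _, _ & _]; congr (_ == 1).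
  by rewrite expg2 !mulgA.
by rewrite expg2 !mulgA.
Qed.

Lemma step_square fl (a b : gT) T tapes :
  step_code code_square (MState fl [:: x; y; z; a; b] (T :: tapes)) =
  Some (MState fl [:: x; y; z; a ^+ 2; b ^+ 4] (tape_move_right T :: tapes)).
Proof. by do ![rewrite step_code_cons /regval /=]; rewrite !mulg1. Qed.

Lemma step_middle fl (a b : gT) T : a ^+ 2 = y ^+ t -> b ^+ 2 = y ^+ q ->
  step_code code_middle (MState fl [:: x; y; z; a; b]
    [:: T; tape_of_bits [seq c i | i <- index_iota 1 N];
           tape_of_bits [seq d i | i <- index_iota 1 N];
           tape_of_bits [seq e i | i <- index_iota 0 N]]) =
  Some (relations_state (fl && (y ^+ (q - 1) == 1)) (y ^+ t) (y ^+ q) (tape_move_left T)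
    [::] [::] [:: Some (e 0)] 0).
Proof.
move=> at2 bq2; have q0 : 0 < q by rewrite expn_gt0.
have -> : y ^+ (q - 1) = b ^+ 2 * y^-1 by rewrite bq2 expgnFr.
rewrite /relations_state /ypow1 /ypow2 -at2 -bq2.
do ![rewrite step_code_cons /regval /=]; rewrite !mulg1.
have -> : accC 0 = x * x by rewrite /accC big_nil mul1g.
have -> : accD 0 = x by rewrite /accD big_nil mul1g.
have -> : accE 0 = (if e 0 then x * x else 1).
  by rewrite /accE big_seq1 [xc 0]conjg1; case: (e 0).
rewrite /xc !expg0 !conjg1; congr (Some (MState _ _ _)).
  by rewrite mulgA; case: (e 0).
rewrite /data_tape /tape_cursor /tape_of_bits /index_iota subn0 subSS subn0.
by rewrite /tape_move_right /= -!map_comp.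
Qed.

Lemma step_end fl A Q T lc ld le :
  exists regs tapes,
  step_code code_end (relations_state fl A Q T lc ld le (2 * m)) =
  Some (MState (fl && relations_hold (Sz_R2 m c d e x y)) regs tapes).
Proof.
have xS k : (x ^ (y ^+ k)) ^ y = x ^ (y ^+ k.+1) by rewrite expgSr conjgM.
do ![rewrite step_code_cons /regval /=]; rewrite /step_code /= !conj_word !xS.
eexists; eexists; congr (Some (MState _ _ _)).
rewrite /regval /= -andbA /relations_hold /= andbT -/(xc N) [Sz_x x y 0]conjg1.
rewrite -[Sz_x x y N]/(xc N); move: (xc N) => u.
rewrite !mulg1 (mulgA u (accD _)) divg_eq1 (mulgA u u) -expg2 /accC /accD.
by rewrite (mulgA (u ^+ 2)) (mulgA u).
Qed.

End Correctness.

(** * Loops, complete runs and the time bound *)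

Definition unary_tape (i j : nat) : tape :=
  tape_cursor (nseq i (Some true)) (nseq j (Some true)).

(** The head is on the last of k remaining marks, or on a blank, which stops the loop. *)
Definition unary_tape_left (k : nat) (r : seq (option bool)) : tape :=
  Tape (nseq k.-1 (Some true)) (if k is 0 then None else Some true) r.

Lemma unary_tape_move_left k :
  tape_move_left (unary_tape k 0) = unary_tape_left k [:: None].
Proof. by case: k. Qed.

Lemma unary_tape_left_move k r :
  exists r', tape_move_left (unary_tape_left k.+1 r) = unary_tape_left k r'.
Proof. by case: k => [|k]; eexists. Qed.

Definition square_loop_cost (j : nat) : nat := (j * (code_cost code_square).+1).+1.
Definition relations_loop_cost (k : nat) : nat :=
  (k * (code_cost code_relations + (code_cost code_relations +
      code_cost [:: IMoveLeft 0])).+1).+1.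

Lemma relations_hold_flatten (G : groupType) (ss : seq (seq (G * G))) :
  relations_hold (flatten ss) = all (@relations_hold G) ss.
Proof. by elim: ss => //= s ss <-; rewrite [LHS]all_cat. Qed.

Section Runs.
Variables (m : nat) (c d e : nat -> bool) (gT : finGroupType) (B : black_box gT).
Variables x y z : gT.
Local Notation N := (2 * m).+1.
Local Notation t := (Sz_t m).
Local Notation q := (Sz_q m).
Local Notation loop := (While (TestSymbol 1%N (Some true))).

Lemma runs_init sx sy sz :
  bb_decode sx = Some x -> bb_decode sy = Some y -> bb_decode sz = Some z ->
  runs (B := B) init_program 3 (input_state (Sz_input m c d e) [:: sx; sy; sz])
    (fun st => models st (MState true [:: x; y; z]
       [:: unary_tape 0 m; tape_of_bits [seq c i | i <- index_iota 1 N];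
           tape_of_bits [seq d i | i <- index_iota 1 N];
           tape_of_bits [seq e i | i <- index_iota 0 N]])).
Proof.
move=> dx dy dz; set st := input_state _ _.
pose st0 := set_tape 0 (tape_write (Some true)) st.
apply: (runs_seq (k1 := 1) (k2 := 2) (Q1 := fun st' => st' = st0)).
  by exists st0, 1%N; rewrite mul1n bb_time_gt0; split=> //; apply: exec_write.
move=> _ ->.
have h0 : holds_reg st0 0 x by exists sx.
apply: runs_seq (runs_Inv 4 h0) _ => st1 [t1 h1 r1].
have h01 : holds_reg st1 0 x by exists sx; rewrite // r1.
apply: runs_weaken (runs_Mul 3 h01 h1) => // st2 [t2 h2 r2].
split.
- by rewrite t2 t1.
- rewrite t2 t1 => -[|[|[|[|k]]]] //=; last by rewrite !nth_nil.
  by rewrite /unary_tape /tape_of_bits map_nseq.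
- by rewrite mulgV in h2.
- by case=> [|[|[|i]]] //= _; [exists sx | exists sy | exists sz]; rewrite // r2 // r1.
Qed.

Lemma runs_square_loop fl i j tapes (st : state B) :
  models st (MState fl [:: x; y; z; y ^+ (2 ^ i)%N; y ^+ (4 ^ i)%N]
    (unary_tape i j :: tapes)) ->
  runs (loop (compile code_square)) (square_loop_cost j) st (fun st' =>
    models st' (MState fl [:: x; y; z; y ^+ (2 ^ (i + j))%N; y ^+ (4 ^ (i + j))%N]
      (unary_tape (i + j) 0 :: tapes))).
Proof.
elim: j i st => [|j IHj] i st Ma.
  rewrite addn0; apply: runs_while_false => //.
  by rewrite /= (models_tapes Ma).
rewrite /square_loop_cost mulSn -addnS addSn.
apply: runs_while_true (runs_code (step_square _ _ _ _ _ _ _ _) Ma) _.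
  by rewrite /= (models_tapes Ma).
rewrite -!expgnA -!expnSr -addSnnS => st1 M1; exact: IHj M1.
Qed.

Lemma runs_relations_loop fl A Q k r lc ld le i (st : state B) :
  (i + 2 * k = 2 * m)%N ->
  models st (relations_state m c d e x y z fl A Q (unary_tape_left k r) lc ld le i) ->
  runs (loop (Seq (compile code_relations) (Seq (compile code_relations)
          (compile [:: IMoveLeft 0])))) (relations_loop_cost k) st
    (fun st' => exists T lc' ld' le', models st' (relations_state m c d e x y z
      (fl && all (fun j => relations_hold (Sz_R1_at m x y j)) (iota i.+1 (2 * k)))
      A Q T lc' ld' le' (2 * m))).
Proof.
elim: k fl r lc ld le i st => [|k IHk] fl r lc ld le i st ik Ma.
  have -> : (2 * m = i)%N by lia.
  rewrite andbT; apply: runs_while_false; first by rewrite /= (models_tapes Ma).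
  by exists (unary_tape_left 0 r), lc, ld, le.
have im : i < 2 * m by lia.
have im1 : i.+1 < 2 * m by lia.
have [r' rE] := unary_tape_left_move k r.
rewrite /relations_loop_cost mulSn -addnS addSn.
apply: runs_while_true.
- by rewrite /= (models_tapes Ma).
- have step1 := step_relations c d e x y z _ _ _ _ _ _ _ im.
  have step2 := step_relations c d e x y z _ _ _ _ _ _ _ im1.
  apply: runs_seq (runs_code (step1 _ _ _ _ _ _ _) Ma) _ => st1 M1.
  apply: runs_seq (runs_code (step2 _ _ _ _ _ _ _) M1) _ => st2 M2.
  apply: (runs_code _ M2); rewrite step_code_cons /= rE; reflexivity.
move=> st1 M1.
apply: runs_weaken (IHk _ _ _ _ _ _ _ _ M1) => //; last lia.
by move=> st2; rewrite mulnS /= -!andbA.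
Qed.

Lemma runs_end fl A Q T lc ld le (st : state B) :
  models st (relations_state m c d e x y z fl A Q T lc ld le (2 * m)%N) ->
  runs (compile code_end) (code_cost code_end) st (fun st' =>
    answer st' = fl && relations_hold (Sz_R2 m c d e x y)).
Proof.
have [regs [tapes E]] := step_end m c d e x y z fl A Q T lc ld le.
move=> M; apply: runs_weaken (runs_code E M) => // st' M'.
by rewrite /answer (models_flag M') /=; case: (_ && _).
Qed.

Lemma Sz_program_runs sx sy sz :
  bb_decode sx = Some x -> bb_decode sy = Some y -> bb_decode sz = Some z ->
  runs (B := B) Sz_program
    (3 + (code_cost code_start + (square_loop_cost m + (code_cost code_middle +
       (relations_loop_cost m + code_cost code_end)))))
    (input_state (Sz_input m c d e) [:: sx; sy; sz])
    (fun st => answer st = relations_hold (Sz_relations m c d e x y z)).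
Proof.
move=> dx dy dz.
apply: runs_seq (runs_init dx dy dz) _ => st1 M1.
apply: runs_seq (runs_code (step_start _ _ _ _ _) M1) _ => st2 M2.
apply: runs_seq (runs_square_loop (i := 0) M2) _ => st3; rewrite add0n => M3.
have at2 : (y ^+ (2 ^ m)%N) ^+ 2 = y ^+ t by rewrite -expgnA -expnSr.
have bq2 : (y ^+ (4 ^ m)%N) ^+ 2 = y ^+ q.
  by rewrite -expgnA -(expnM 2 2) -expnSr.
apply: runs_seq (runs_code (step_middle c d e _ _ _ _ at2 bq2) M3) _ => st4.
rewrite unary_tape_move_left => M4.
apply: runs_seq (runs_relations_loop _ M4) _ => [|st5 [T [lc [ld [le M5]]]]].
  by rewrite add0n.
apply: runs_weaken (runs_end M5) => // st6 ->.
rewrite [RHS]/relations_hold /Sz_relations !all_cat -!/(relations_hold _).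
rewrite relations_hold_flatten all_map /index_iota subSS subn0 [RHS]/=.
(* The program tests the relations in another order than the presentation lists them. *)
have reorder (x4 yq r1 r2 z2 yz xz : bool) :
    [&& x4, z2, yz & xz] && yq && r1 && r2 =
    [&& x4 && (yq && true), r1, r2, z2, yz, xz & true].
  by case: x4; case: yq; case: r1; case: r2; case: z2; case: yz; case: xz.
exact: reorder.
Qed.

End Runs.

Definition Sz_time_constant : nat :=
  (7 + code_cost code_start + code_cost code_square + code_cost code_middle +
   2 * code_cost code_relations + code_cost [:: IMoveLeft 0] + code_cost code_end)%N.

(** The logarithm of q is 2m + 1, which is at least 1 and at least m, so it absorbs both the fixed
    code and the m rounds of each loop. *)
Lemma Sz_program_cost m :
  (3 + (code_cost code_start + (square_loop_cost m + (code_cost code_middle +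
       (relations_loop_cost m + code_cost code_end)))) <=
  Sz_time_constant * trunc_log 2 (Sz_q m))%N.
Proof.
rewrite /Sz_time_constant /square_loop_cost /relations_loop_cost /Sz_q trunc_expnK //.
by do !move: (code_cost _) => ?; nia.
Qed.

Local Close Scope group_scope.

Theorem theorem3p1 :
  (forall (m : nat) (F : finFieldType) (hF : #|F| = Sz_q m) (w : F)
          (c d e : nat -> bool),
     0 < m ->
     ((Sz_q m).-1.-primitive_root w)%R ->
     Sz_constants hF w c d e ->
     group_isomorphic [subg (Sz m w)] (Sz_presentation m c d e)) /\
  (exists (P : program) (C : nat),
     forall (m : nat) (F : finFieldType) (hF : #|F| = Sz_q m) (w : F)
            (c d e : nat -> bool),
     0 < m ->
     ((Sz_q m).-1.-primitive_root w)%R ->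
     Sz_constants hF w c d e ->
     forall (gT : finGroupType) (B : black_box gT)
            (sx sy sz : bb_string B) (x y z : gT),
     bb_decode sx = Some x -> bb_decode sy = Some y -> bb_decode sz = Some z ->
     #|[set x; y; z]| = 3 ->
     <<[set x; y; z]>>%g = [set: gT] ->
     exists (st : state B) (n : nat),
       [/\ exec P (input_state (Sz_input m c d e) [:: sx; sy; sz]) st n,
           n <= C * (bb_time B * trunc_log 2 (Sz_q m))
         & answer st = relations_hold (Sz_relations m c d e x y z)]).
Proof.
split=> [m F hF w c d e _|]; first exact: Sz_presentation_iso.
exists Sz_program, Sz_time_constant.
move=> m F hF w c d e _ _ _ gT B sx sy sz x y z dx dy dz _ _.
have [st [n [ex n_le ans]]] := @Sz_program_runs m c d e gT B x y z sx sy sz dx dy dz.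
exists st, n; split=> //; apply: leq_trans n_le _.
by rewrite mulnCA mulnC leq_mul2l Sz_program_cost orbT.
Qed.
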